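(* Let $F$ be an algebraically closed field of characteristic not $2$, let $A=\bigoplus_{i=1}^{n}A_i$ be a semisimple finite-dimensional Jordan algebra over $F$, where the $A_i$ are simple algebras, let $\delta\in F$, and let $\phi$ be a non-trivial $\delta$-derivation of $A$. Then $\delta=\frac12$, and there exist $\alpha_1,\dots,\alpha_n\in F$ such that for every $x=\sum_{i=1}^{n}x_i$ with $x_i\in A_i$ one has $\phi(x)=\sum_{i=1}^{n}\alpha_i x_i$.
   Context: A Jordan algebra over a field $F$ of characteristic not $2$ is a (not necessarily associative) $F$-algebra satisfying the identities $xy=yx$ and $(x^2y)x=x^2(yx)$. For an $F$-algebra $A$ and $\delta\in F$, a $\delta$-derivation of $A$ is an $F$-linear map $\phi:A\to A$ with $\phi(xy)=\delta(x\phi(y)+\phi(x)y)$ for all $x,y\in A$. In particular a $1$-derivation is an ordinary derivation, and a $0$-derivation is a linear map $\phi:A\to A$ with $\phi(A^2)=0$. A non-trivial $\delta$-derivation is a $\delta$-derivation that is neither a $1$-derivation nor a $0$-derivation. *)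

(* Defs.v *)
From HB Require Import structures.
From mathcomp Require Import all_boot all_order all_algebra.
From mathcomp Require Import sesquilinear.

Set Implicit Arguments.
Unset Strict Implicit.
Unset Printing Implicit Defensive.

Import GRing.Theory.
Local Open Scope ring_scope.

(* A finite-dimensional, not necessarily associative F-algebra is given by a
   vectType A together with its product, a bilinear map mul : A -> A -> A. *)
Section NonassociativeAlgebras.

Variables (F : fieldType) (A : vectType F) (mul : {bilinear A -> A -> A}).

Definition is_jordan : Prop :=
  (forall x y : A, mul x y = mul y x) /\
  (forall x y : A, mul (mul (mul x x) y) x = mul (mul x x) (mul y x)).

Definition is_subalgebra (S : {vspace A}) : Prop :=
  forall x y : A, x \in S -> y \in S -> mul x y \in S.

(* I is a two-sided ideal of the subalgebra S, not of the ambient algebra. *)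
Definition is_ideal_of (S I : {vspace A}) : Prop :=
  (I <= S)%VS /\
  (forall x y : A, x \in S -> y \in I -> mul x y \in I /\ mul y x \in I).

(* Simplicity includes S^2 <> 0: the one-dimensional algebra with zero product
   has no proper nonzero ideal but is not simple. *)
Definition is_simple_algebra (S : {vspace A}) : Prop :=
  [/\ is_subalgebra S,
      exists x y : A, [/\ x \in S, y \in S & mul x y != 0]
    & forall I : {vspace A}, is_ideal_of S I -> I = 0%VS \/ I = S].

(* Internal direct sum of algebras, with componentwise product: the cross
   products vanish. *)
Definition is_algebra_direct_sum (n : nat) (A_ : 'I_n -> {vspace A}) : Prop :=
  [/\ directv (\sum_(i < n) A_ i)%VS,
      (\sum_(i < n) A_ i)%VS = fullv,
      forall i : 'I_n, is_subalgebra (A_ i)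
    & forall (i j : 'I_n) (x y : A),
        i != j -> x \in A_ i -> y \in A_ j -> mul x y = 0].

Definition is_delta_derivation (delta : F) (phi : {linear A -> A}) : Prop :=
  forall x y : A, phi (mul x y) = delta *: (mul x (phi y) + mul (phi x) y).

Definition is_nontrivial_delta_derivation
    (delta : F) (phi : {linear A -> A}) : Prop :=
  [/\ is_delta_derivation delta phi,
      ~ is_delta_derivation 1 phi
    & ~ is_delta_derivation 0 phi].

End NonassociativeAlgebras.

(* Main.v *)
Require Import Defs.
From Stdlib Require Import Classical.
From HB Require Import structures.
From mathcomp Require Import all_boot all_order all_algebra.
From mathcomp Require Import sesquilinear ring.

Set Implicit Arguments.
Unset Strict Implicit.
Unset Printing Implicit Defensive.

Import GRing.Theory.
Local Open Scope ring_scope.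

(* A simple algebra [S] has a unit, so a nontrivial delta-derivation satisfies
   [phi 1 = 2 delta (phi 1)] with [phi 1 <> 0]; hence [delta = 1/2] and [phi] is
   the multiplication by some [a] with [2 a (x y) = (a x) y + x (a y)].  For such
   [a], [D x y = a (x y) - x (a y)] is alternating and a derivation in each
   argument, so it respects the Peirce decomposition of every idempotent, and
   simplicity forces [D = 0] as soon as [S] has an idempotent other than [0] and
   [1].  Then the eigenspaces of the multiplication by [a] are ideals, so [a] acts
   as a scalar.  If [0] and [1] are the only idempotents, the nilpotents form an
   ideal of codimension one, so [S] is the base field.

   The unit comes from nondegeneracy.  By the fundamental formula
   [U_(U_x y) = U_x U_y U_x], the absolute zero divisors span an ideal; it is not
   [S], since a primitive idempotent [e] would be a sum of nilpotents [U_e z] of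
   the local algebra [U_e S].  Taking [e] with minimal [S_0(e)], the nil algebra
   [S_0(e)] vanishes by an Engel-type theorem, then the squares of [S_(1/2)(e)]
   are absolute zero divisors, so [S_(1/2)(e) = 0] and [e] is the unit. *)

(** * Deciding identities of the free commutative nonassociative ring *)

Section FreeCommutativeAlgebra.

Inductive nexp : Type :=
  NAtom of nat | NZero | NAdd of nexp & nexp | NOpp of nexp
| NMuln of nexp & nat | NMul of nexp & nexp.

Inductive ntree : Type := NLeaf of nat | NNode of ntree & ntree.

Fixpoint ntree_eqb s t : bool :=
  match s, t with
  | NLeaf i, NLeaf j => i == j
  | NNode s1 s2, NNode t1 t2 => ntree_eqb s1 t1 && ntree_eqb s2 t2
  | _, _ => false
  end.

Fixpoint ntree_leb s t : bool :=
  match s, t with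
  | NLeaf i, NLeaf j => (i <= j)%N
  | NLeaf _, _ => true
  | _, NLeaf _ => false
  | NNode s1 s2, NNode t1 t2 =>
      if ntree_eqb s1 t1 then ntree_leb s2 t2 else ntree_leb s1 t1
  end.

Definition npoly := seq (int * ntree).

Fixpoint npoly_ins (m : int * ntree) (p : npoly) : npoly :=
  if p is m' :: p' then
    if ntree_eqb m.2 m'.2 then (intZmod.addz m.1 m'.1, m'.2) :: p'
    else m' :: npoly_ins m p'
  else [:: m].

Definition npoly_add (p q : npoly) : npoly := foldr npoly_ins q p.

(** Ordering the two factors gives every commutative monomial one normal form; the raw integer
    operations reduce under [vm_compute]. *)
Definition nmon_mul (m m' : int * ntree) : int * ntree :=
  (intRing.mulz m.1 m'.1,
   if ntree_leb m.2 m'.2 then NNode m.2 m'.2 else NNode m'.2 m.2).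

Definition npoly_mul (p q : npoly) : npoly :=
  foldr (fun m => npoly_add (map (nmon_mul m) q)) [::] p.

Definition npoly_scale (c : int) (p : npoly) : npoly :=
  map (fun m => (intRing.mulz c m.1, m.2)) p.

Fixpoint nnorm (e : nexp) : npoly :=
  match e with
  | NAtom i => [:: (1%:Z, NLeaf i)]
  | NZero => [::]
  | NAdd e1 e2 => npoly_add (nnorm e1) (nnorm e2)
  | NOpp e1 => npoly_scale (Negz 0) (nnorm e1)
  | NMuln e1 n => npoly_scale (Posz n) (nnorm e1)
  | NMul e1 e2 => npoly_mul (nnorm e1) (nnorm e2)
  end.

Definition npoly_zero (p : npoly) : bool :=
  all (fun m => if m.1 is Posz 0 then true else false) p.

Variables (F : fieldType) (A : vectType F) (mul : {bilinear A -> A -> A}).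
Hypothesis mulC : forall x y, mul x y = mul y x.
Variable env : seq A.

Fixpoint neval (e : nexp) : A :=
  match e with
  | NAtom i => nth 0 env i
  | NZero => 0
  | NAdd e1 e2 => neval e1 + neval e2
  | NOpp e1 => - neval e1
  | NMuln e1 n => neval e1 *+ n
  | NMul e1 e2 => mul (neval e1) (neval e2)
  end.

Fixpoint teval (t : ntree) : A :=
  match t with
  | NLeaf i => nth 0 env i
  | NNode s t => mul (teval s) (teval t)
  end.

Definition peval (p : npoly) : A := \sum_(m <- p) teval m.2 *~ m.1.

Lemma ntree_eqbP s t : ntree_eqb s t -> s = t.
Proof.
elim: s t => [i|s1 IH1 s2 IH2] [j|t1 t2] //=; first by move/eqP->.
by case/andP=> /IH1 -> /IH2 ->.
Qed.

Lemma peval_ins m p : peval (npoly_ins m p) = teval m.2 *~ m.1 + peval p.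
Proof.
elim: p => [|m' p IH] /=; first by rewrite /peval big_seq1 big_nil addr0.
case: ifP => [/ntree_eqbP E|_]; last first.
  by rewrite /peval !big_cons -/(peval _) IH addrCA.
by rewrite /peval !big_cons /= addrA E -mulrzDr.
Qed.

Lemma peval_add p q : peval (npoly_add p q) = peval p + peval q.
Proof.
elim: p => [|m p IH] /=; first by rewrite /peval big_nil add0r.
by rewrite peval_ins IH addrA /peval big_cons.
Qed.

Lemma peval_scale c p : peval (npoly_scale c p) = peval p *~ c.
Proof.
rewrite /peval /npoly_scale big_map mulrz_suml; apply: eq_bigr => m _ /=.
by rewrite -mulrzA -[intRing.mulz _ _]/(c * m.1) mulrC.
Qed.

Lemma bilinear_mulrz u v (a b : int) : mul (u *~ a) (v *~ b) = mul u v *~ (a * b).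
Proof.
rewrite -![_ *~ a]scaler_int -![_ *~ b]scaler_int linearZl_LR linearZr_LR.
by rewrite !scaler_int mulrC mulrzA.
Qed.

Lemma peval_mul p q : peval (npoly_mul p q) = mul (peval p) (peval q).
Proof.
elim: p => [|m p IH] /=; first by rewrite /peval big_nil linear0l.
rewrite peval_add IH /peval big_cons linearDl; congr (_ + _).
rewrite big_map linear_sum; apply: eq_bigr => m' _.
rewrite -[RHS]/(mul (teval m.2 *~ m.1) (teval m'.2 *~ m'.1)) bilinear_mulrz /=.
congr (_ *~ _).
by case: ifP => _ //=; rewrite mulC.
Qed.

Lemma nnormE e : neval e = peval (nnorm e).
Proof.
elim: e => [i||e1 IH1 e2 IH2|e1 IH1|e1 IH1 n|e1 IH1 e2 IH2] /=.
- by rewrite /peval big_seq1.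
- by rewrite /peval big_nil.
- by rewrite peval_add IH1 IH2.
- by rewrite peval_scale IH1 mulrN1z.
- by rewrite peval_scale IH1.
- by rewrite peval_mul IH1 IH2.
Qed.

Lemma nnorm_eq e1 e2 :
  npoly_zero (nnorm (NAdd e1 (NOpp e2))) -> neval e1 = neval e2.
Proof.
move=> z; apply/eqP; rewrite -subr_eq0; apply/eqP.
rewrite -[_ - _]/(neval (NAdd e1 (NOpp e2))) nnormE /peval.
elim: (nnorm _) z => [|[c t] p IH] /=; first by rewrite big_nil.
by case: c => [[|c]|c] //= /IH; rewrite big_cons /= mulr0z add0r.
Qed.

End FreeCommutativeAlgebra.

Ltac nlookup x env :=
  lazymatch env with
  | x :: _ => constr:(O)
  | _ :: ?env' => let n := nlookup x env' in constr:(S n)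
  end.

Ltac nadd_atom x env :=
  match env with
  | context [cons x _] => env
  | _ => constr:(x :: env)
  end.

Ltac natoms M e env :=
  lazymatch e with
  | ?a + ?b => let env := natoms M a env in natoms M b env
  | - ?a => natoms M a env
  | ?a *+ _ => natoms M a env
  | 0 => env
  | ?f ?a ?b =>
      match constr:(true) with
      | _ => let _ := constr:(ltac:(constr_eq f M; exact I) : True) in
             let env := natoms M a env in natoms M b env
      | _ => nadd_atom e env
      end
  | _ => nadd_atom e env
  end.

Ltac nreify M e env :=
  lazymatch e with
  | ?a + ?b => let a := nreify M a env in let b := nreify M b env in
               constr:(NAdd a b)
  | - ?a => let a := nreify M a env in constr:(NOpp a)
  | ?a *+ ?n => let a := nreify M a env in constr:(NMuln a n)
  | 0 => constr:(NZero)
  | ?f ?a ?b =>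
      match constr:(true) with
      | _ => let _ := constr:(ltac:(constr_eq f M; exact I) : True) in
             let a := nreify M a env in let b := nreify M b env in
             constr:(NMul a b)
      | _ => let n := nlookup e env in constr:(NAtom n)
      end
  | _ => let n := nlookup e env in constr:(NAtom n)
  end.

(* Decides the equalities that hold in the free commutative nonassociative ring. *)
Ltac nring mul mulC :=
  lazymatch goal with
  | |- @eq ?T ?l ?r =>
    let M := constr:(mul : T -> T -> T) in
    let M := lazymatch M with (?m : _) => m end in
    let env := natoms M l (@nil T) in
    let env := natoms M r env in
    let el := nreify M l env in
    let er := nreify M r env in
    refine (@nnorm_eq _ _ mul mulC env el er _); vm_compute; reflexivity
  end.

(** A known equality is subtracted from the goal, leaving an identity of the free algebra for
    [nring]. *)
Lemma lincomb1 (V : zmodType) (u v l1 r1 : V) :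
  l1 = r1 -> u - v = l1 - r1 -> u = v.
Proof. by move=> ->; rewrite subrr => /eqP; rewrite subr_eq0 => /eqP. Qed.

Lemma lincomb2 (V : zmodType) (u v l1 r1 l2 r2 : V) :
  l1 = r1 -> l2 = r2 -> u - v = (l1 - r1) + (l2 - r2) -> u = v.
Proof. by move=> -> ->; rewrite !subrr addr0 => /eqP; rewrite subr_eq0 => /eqP. Qed.

(** * Jordan identities and the fundamental formula *)

Section JordanIdentities.

Variables (F : fieldType) (charF : 2%N \notin [pchar F]).
Variables (A : vectType F) (mul : {bilinear A -> A -> A}).
Hypothesis jordanA : is_jordan mul.

Local Notation "x ** y" := (mul x y) (at level 40, left associativity).
Implicit Types (x y z w t u v : A).

Lemma two_neq0 : 2 != 0 :> F.
Proof. by apply/negP => F2; case/negP: charF; rewrite inE /= F2. Qed.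

Lemma jmulC x y : x ** y = y ** x. Proof. by case: jordanA => mC _; rewrite mC. Qed.

Lemma mulr2n_inj u v : u *+ 2 = v *+ 2 -> u = v.
Proof. by rewrite -!scaler_nat => /(scalerI two_neq0). Qed.

(* [jUU] is the polarization of [jU] and [jV x y t] is the triple product [{x, y, t}]. *)
Definition jU x t := (x ** (x ** t)) *+ 2 - (x ** x) ** t.
Definition jUU x z t := (x ** (z ** t) + z ** (x ** t) - (x ** z) ** t) *+ 2.
Definition jV x y t := ((x ** y) ** t + x ** (y ** t) - y ** (x ** t)) *+ 2.

Local Ltac jring := rewrite /jUU /jU /jV; nring mul jmulC.

(** The Jordan identity is cubic in [x]: its values at [x + z], [x - z] and [z] combine to twice the
    part quadratic in [x] and linear in [z]. *)
Lemma jordan_lin1 x y z :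
  (((x ** z) ** y) ** x) *+ 2 + ((x ** x) ** y) ** z
  = ((x ** z) ** (y ** x)) *+ 2 + (x ** x) ** (y ** z).
Proof.
apply: mulr2n_inj.
have H : forall a b c d e f : A,
  a = b -> c = d -> e = f -> a - c - e *+ 2 = b - d - f *+ 2.
  by move=> a b c d e f -> -> ->.
apply: (lincomb1 (H _ _ _ _ _ _ (jordanA.2 (x + z) y) (jordanA.2 (x - z) y) (jordanA.2 z y))).
jring.
Qed.

Lemma jordan_lin x z w y :
  ((x ** z) ** y) ** w + ((x ** w) ** y) ** z + ((z ** w) ** y) ** x
  = (x ** z) ** (y ** w) + (x ** w) ** (y ** z) + (z ** w) ** (y ** x).
Proof.
apply: mulr2n_inj.
have H : forall a b c d e f : A,
  a = b -> c = d -> e = f -> a - c - e = b - d - f by move=> a b c d e f -> -> ->.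
apply: (lincomb1 (H _ _ _ _ _ _ (jordan_lin1 (x + w) y z) (jordan_lin1 x y z)
  (jordan_lin1 w y z))).
jring.
Qed.

Lemma mul_comm_deriv x y z w :
  x ** (y ** (z ** w)) - y ** (x ** (z ** w))
  = (x ** (y ** z) - y ** (x ** z)) ** w + z ** (x ** (y ** w) - y ** (x ** w)).
Proof.
apply: (lincomb2 (jordan_lin x z w y) (esym (jordan_lin y z w x))).
jring.
Qed.

Lemma mul_jU a z t : a ** jU z t + jU z (a ** t) = jUU (a ** z) z t.
Proof.
have H : forall a b c d : A, a = b -> c = d -> a *+ 2 - c = b *+ 2 - d.
  by move=> ? ? ? ? -> ->.
apply: (lincomb1 (H _ _ _ _ (jordan_lin a z t z) (jordan_lin a z z t))).
jring.
Qed.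

(** Half of [jV x y] is multiplication by [x ** y] plus the commutator of the multiplications by [x]
    and [y]: the first obeys [mul_jU], the second differentiates [jU z] by Leibniz. *)
Lemma jV_jU x y z t : jV x y (jU z t) + jU z (jV y x t) = jUU (jV x y z) z t.
Proof.
have H1 := mul_jU (x ** y) z t.
have H2 := mul_comm_deriv x y z (z ** t).
have H3 := congr1 (mul z) (mul_comm_deriv x y z t).
have H4 := mul_comm_deriv x y (z ** z) t.
have H5 := congr1 (mul^~ t) (mul_comm_deriv x y z z).
have H : forall a b c d e f g h k l : A,
  a = b -> c = d -> e = f -> g = h -> k = l ->
  a *+ 2 + c *+ 4 + e *+ 4 - g *+ 2 - k *+ 2 = b *+ 2 + d *+ 4 + f *+ 4 - h *+ 2 - l *+ 2.
  by move=> a b c d e f g h k l -> -> -> -> ->.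
apply: (lincomb1 (H _ _ _ _ _ _ _ _ _ _ H1 H2 H3 H4 H5)).
cbv beta; jring.
Qed.

Lemma jV_jU_same x y t : jV x y (jU x t) = jU x (jV y x t).
Proof.
have H1 := congr1 (mul x) (mul_jU y x t).
have H2 := mul_jU y x (x ** t).
have H3 := jordan_lin x x (x ** y) t.
have H4 := jordanA.2 x (y ** t).
have H5 := congr1 (mul y) (jordanA.2 x t).
have H : forall a b c d e f g h k l : A,
  a = b -> c = d -> e = f -> g = h -> k = l ->
  a *+ 2 - c *+ 2 - e *+ 2 + g *+ 2 + k *+ 2 = b *+ 2 - d *+ 2 - f *+ 2 + h *+ 2 + l *+ 2.
  by move=> a b c d e f g h k l -> -> -> -> ->.
apply: (lincomb1 (H _ _ _ _ _ _ _ _ _ _ H1 H2 H3 H4 H5)).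
cbv beta; jring.
Qed.

Lemma jUU_jU_same x y t : jUU (jU x y) x t = jU x (jV y x t).
Proof.
apply: mulr2n_inj.
have H := jV_jU x y x t; rewrite jV_jU_same in H.
apply: (lincomb1 (esym H)); jring.
Qed.

Lemma jV_jUU x y z w t :
  jV x y (jUU z w t) + jUU z w (jV y x t) = jUU (jV x y z) w t + jUU z (jV x y w) t.
Proof.
have H : forall a b c d e f : A,
  a = b -> c = d -> e = f -> a - c - e = b - d - f by move=> a b c d e f -> -> ->.
apply: (lincomb1 (H _ _ _ _ _ _ (jV_jU x y (z + w) t) (jV_jU x y z t) (jV_jU x y w t))).
jring.
Qed.

Lemma jV_sqr y x z : jV y x (jV y x z) = jV (jU y x) x z + (jU y (jU x z)) *+ 2.
Proof. by apply: (lincomb1 (esym (jV_jU z x y x))); jring. Qed.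

(** Take [z = jU x y] and [w = x] in [jV_jUU]: every term starts with [U_x] except [4 U_(U_x y)],
    and [jV_sqr] reduces the others to [4 U_x U_y U_x]. *)
Lemma jU_fundamental x y t : jU (jU x y) t = jU x (jU y (jU x t)).
Proof.
apply: mulr2n_inj; apply: mulr2n_inj.
have H1 := jV_jUU x y (jU x y) x t.
have H2 := jV_sqr y x t.
have H3 := jUU_jU_same x y t.
have H4 := jUU_jU_same x (jU y x) t.
have H5 := jUU_jU_same x y (jV y x t).
have H6 := jV_jU_same x y (jV y x t).
have H7 := jV_jU_same x y y.
have E1 : jV y x y = jU y x *+ 2 by jring.
have E2 : jV x y x = jU x y *+ 2 by jring.
rewrite H3 H5 H6 H7 E1 E2 in H1; rewrite H2 in H1.
have E3 : jU x (jU y x *+ 2) = jU x (jU y x) *+ 2 by jring.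
have E4 : jUU (jU x (jU y x) *+ 2) x t = jUU (jU x (jU y x)) x t *+ 2 by jring.
rewrite E3 E4 H4 in H1.
move: H1; set w := jU x y; set p := jU y (jU x t); set q := jV _ _ t.
move=> H1; apply: (lincomb1 (esym H1)); jring.
Qed.

Lemma mul_sqr_comm x t : (x ** x) ** (x ** t) = x ** ((x ** x) ** t).
Proof. apply: (lincomb1 (esym (jordanA.2 x t))); jring. Qed.

Lemma jmulDl x y t : (x + y) ** t = x ** t + y ** t.
Proof. exact: linearDl. Qed.

Lemma jmulDr x y t : t ** (x + y) = t ** x + t ** y.
Proof. exact: linearD. Qed.

Lemma jmulBl x y t : (x - y) ** t = x ** t - y ** t.
Proof. exact: linearBl. Qed.

Lemma jmulBr x y t : t ** (x - y) = t ** x - t ** y.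
Proof. exact: linearB. Qed.

Lemma jmul0l t : 0 ** t = 0.
Proof. exact: linear0l. Qed.

Lemma jmul0r t : t ** 0 = 0.
Proof. exact: linear0r. Qed.

Lemma jmulZl c x t : (c *: x) ** t = c *: (x ** t).
Proof. exact: linearZl_LR. Qed.

Lemma jmulZr c x t : x ** (c *: t) = c *: (x ** t).
Proof. exact: linearZr_LR. Qed.

Lemma mul_sumr I (r : seq I) (P : pred I) (G : I -> A) t :
  t ** (\sum_(i <- r | P i) G i) = \sum_(i <- r | P i) t ** G i.
Proof. exact: linear_sum. Qed.

Lemma mul_suml I (r : seq I) (P : pred I) (G : I -> A) t :
  (\sum_(i <- r | P i) G i) ** t = \sum_(i <- r | P i) G i ** t.
Proof. by apply: (big_morph (fun u => u ** t)) => [u v|]; rewrite ?linearDl ?linear0l. Qed.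

(** * Powers and polynomials in one element *)

Fixpoint jpow x n := if n is n'.+1 then x ** jpow x n' else x.

(** The recursion [rec] expresses multiplication by [x ** (x ** z)] through those by [x], [x ** x],
    [z] and [x ** z], so the induction carries two consecutive powers. *)
Lemma jpow_comm x n t : jpow x n ** (x ** t) = x ** (jpow x n ** t).
Proof.
suff : forall s, jpow x n ** (x ** s) = x ** (jpow x n ** s) /\
                 jpow x n.+1 ** (x ** s) = x ** (jpow x n.+1 ** s) by move=> /(_ t) [].
elim: n => [|n IH] s /=; first by split=> //; exact: mul_sqr_comm.
split; first exact: (IH s).2.
set z := jpow x n in IH *.
have zC s' : z ** (x ** s') = x ** (z ** s') := (IH s').1.
have xzC s' : (x ** z) ** (x ** s') = x ** ((x ** z) ** s') := (IH s').2.
have rec s' : (x ** (x ** z)) ** s' = ((x ** z) ** (x ** s')) *+ 2 + (x ** x) ** (z ** s')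
    - x ** (x ** (z ** s')) - z ** (x ** (x ** s')).
  by apply: (lincomb1 (jordan_lin x z s' x)); jring.
rewrite !rec !zC !xzC mul_sqr_comm; jring.
Qed.

(** Power associativity; [jpow x n] has exponent [n + 1], hence the successor. *)
Lemma jpow_mul x m n : jpow x m ** jpow x n = jpow x (m + n).+1.
Proof.
elim: n => [|n IH] /=; last by rewrite jpow_comm IH addnS.
by rewrite addn0 jmulC.
Qed.

Lemma jpowS x n : jpow x n.+1 = x ** jpow x n. Proof. by []. Qed.

(* [jev x p] is the value of [p * 'X] at [x]. *)
Definition jev x (p : {poly F}) : A := \sum_(i < size p) p`_i *: jpow x i.

Lemma jevE n x (p : {poly F}) : (size p <= n)%N -> jev x p = \sum_(i < n) p`_i *: jpow x i.
Proof.
move=> le_pn; rewrite /jev (big_ord_widen n (fun i => p`_i *: jpow x i)) // big_mkcond.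
apply: eq_bigr => i _; case: ltnP => // le_pi.
by rewrite nth_default // scale0r.
Qed.

Lemma jev_is_linear x : linear (jev x).
Proof.
move=> c p q; pose n := maxn (size p) (size q).
rewrite !(@jevE n) ?leq_maxl ?leq_maxr //; last first.
  rewrite (leq_trans (size_polyD _ _)) // geq_max leq_maxr andbT.
  by rewrite (leq_trans (size_scale_leq _ _)) ?leq_maxl.
rewrite scaler_sumr -big_split; apply: eq_bigr => i _ /=.
by rewrite coefD coefZ scalerDl scalerA.
Qed.

HB.instance Definition _ x := GRing.isLinear.Build F {poly F} A *:%R (jev x) (jev_is_linear x).

Lemma jev_Xn x n : jev x 'X^n = jpow x n.
Proof.
rewrite /jev size_polyXn (bigD1 ord_max) //= coefXn eqxx scale1r big1 ?addr0 //.
by move=> i /negPf ni; rewrite coefXn -[_ == n]/(i == ord_max) ni scale0r.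
Qed.

Lemma jev_mulX x p : jev x (p * 'X) = x ** jev x p.
Proof.
rewrite [in LHS](@jevE (size p).+1); last first.
  by rewrite (leq_trans (size_polyMleq _ _)) // size_polyX addn2.
rewrite big_ord_recl coefMX eqxx scale0r add0r mul_sumr; apply: eq_bigr => i _.
by rewrite coefMX /= jmulZr.
Qed.

Lemma jev_comm x p t : jev x p ** (x ** t) = x ** (jev x p ** t).
Proof.
rewrite /jev !mul_suml mul_sumr; apply: eq_bigr => i _.
by rewrite !jmulZl jmulZr jpow_comm.
Qed.

Lemma jevC x c : jev x c%:P = c *: x.
Proof. by rewrite -[c%:P]mulr1 mul_polyC linearZ /= -(expr0 'X) jev_Xn. Qed.

Lemma jev_mul x p q : jev x p ** jev x q = jev x (p * q * 'X).
Proof.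
elim/poly_ind: p => [|p c IH]; first by rewrite !mul0r !linear0 linear0l.
rewrite linearD /= linearDl /= jev_mulX jevC jmulZl.
rewrite [(x ** _) ** _]jmulC jev_comm [jev x q ** _]jmulC IH.
by rewrite -!jev_mulX -linearZ -linearD /= !mulrDl -mul_polyC mulrA [_ * 'X * q]mulrAC.
Qed.

Definition jnil x := exists n, jpow x n = 0.

Lemma jpow_eq0 x m n : (m <= n)%N -> jpow x m = 0 -> jpow x n = 0.
Proof.
by move=> /subnK <- x0; elim: (n - m)%N => //= k ->; rewrite linear0r.
Qed.

Lemma annihilating_poly x : exists2 p : {poly F}, p != 0 & jev x p = 0.
Proof.
apply: NNPP => noP; pose d := (\dim {:A}).+1.
pose X := [tuple jpow x i | i < d].
have X_ (i : 'I_d) : X`_i = jpow x i by rewrite -tnth_nth tnth_mktuple.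
suff : free X.
  rewrite /free size_tuple => /eqP dimX.
  by have := dimvS (subvf <<X>>%VS); rewrite dimX ltnn.
apply/freeP => k k0 i; apply: NNPP => ki; apply: noP.
exists (\poly_(j < d) (if insub j is Some o then k o else 0)).
  apply/eqP => /(congr1 (fun p : {poly F} => p`_i)).
  by rewrite coef0 coef_poly ltn_ord valK.
rewrite (@jevE d) ?size_poly // -[RHS]k0; apply: eq_bigr => j _.
by rewrite coef_poly ltn_ord valK X_.
Qed.

Lemma jev_dvd x p q : jev x p = 0 -> jev x (q * p) = 0.
Proof.
move=> p0; elim/poly_ind: q => [|q c IH]; first by rewrite mul0r linear0.
by rewrite mulrDl linearD /= mulrAC jev_mulX IH linear0r mul_polyC linearZ /= p0 scaler0 addr0.
Qed.

(* If [p = r * 'X^k] kills [x] and [r] is prime to ['X], Bezout gives [g] with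
   [g * 'X = 1] modulo [r] and [g = 0] modulo ['X^k]; then [jev x g] is idempotent. *)
Lemma jnil_or_idempotent x :
  jnil x \/ exists g, jev x g != 0 /\ jev x g ** jev x g = jev x g.
Proof.
have [p p0 px] := annihilating_poly x.
have [k [r /implyP/(_ p0) r0 pE]] := multiplicity_XsubC p 0.
rewrite subr0 in pE.
have /Bezout_eq1_coprimepP[[u v] /= uv] : coprimep 'X^(k.+1) r.
  by rewrite coprimep_expl // coprimep_sym -['X]subr0 coprimep_XsubC.
have rE : v * r = 1 - u * 'X^(k.+1) by rewrite -uv addrC addKr.
pose g := u * 'X^k.
have gX : g * 'X = 1 - v * r by rewrite rE /g exprSr mulrA opprB addrC subrK.
have [g0|g0] := eqVneq (jev x g) 0; [left; exists k|right; exists g; split=> //].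
  rewrite -jev_Xn; have -> : 'X^k = ('X^k * 'X) * g + v * p :> {poly F}.
    by rewrite pE -mulrA ['X * g]mulrC gX; ring.
  by rewrite linearD /= (jev_dvd _ g0) (jev_dvd _ px) addr0.
apply/eqP; rewrite jev_mul -subr_eq0 -linearB /=.
have -> : g * g * 'X - g = (- (u * v)) * p by rewrite -mulrA gX /g pE; ring.
by rewrite (jev_dvd _ px).
Qed.

End JordanIdentities.

(** * Engel's theorem for nil algebras *)

Section Engel.

Variables (F : fieldType) (charF : 2%N \notin [pchar F]).
Variables (A : vectType F) (mul : {bilinear A -> A -> A}).
Hypothesis jordanA : is_jordan mul.

Local Notation "x ** y" := (mul x y) (at level 40, left associativity).
Implicit Types (x y z w t u v : A).
Local Ltac jring := rewrite /jUU /jU /jV; nring mul (jmulC jordanA).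

(** The linearized Jordan identity between operators: a product of three multiplications is minus
    its reversal, up to products of at most two. *)
Lemma jordan_op x y z t :
  x ** (y ** (z ** t)) + z ** (y ** (x ** t)) + ((x ** z) ** y) ** t
  = x ** ((y ** z) ** t) + y ** ((x ** z) ** t) + z ** ((x ** y) ** t).
Proof.
have H1 := jordan_lin charF jordanA x z t y; have H2 := jordan_lin charF jordanA x z y t.
by apply: (lincomb2 H1 (esym H2)); jring.
Qed.

Definition stabilizes (B V : {vspace A}) := forall b v, b \in B -> v \in V -> b ** v \in V.

Lemma memv_mulr2n (V : {vspace A}) v : v *+ 2 \in V -> v \in V.
Proof.
by rewrite -scaler_nat => /(rpredZ 2^-1); rewrite scalerA mulVf ?scale1r.
Qed.

Lemma memv_opl (V : {vspace A}) x y z t :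
  z ** (y ** (x ** t)) \in V -> ((x ** z) ** y) ** t \in V ->
  x ** ((y ** z) ** t) \in V -> y ** ((x ** z) ** t) \in V -> z ** ((x ** y) ** t) \in V ->
  x ** (y ** (z ** t)) \in V.
Proof.
move=> V1 V2 V3 V4 V5.
have -> : x ** (y ** (z ** t)) = x ** ((y ** z) ** t) + y ** ((x ** z) ** t) + z ** ((x ** y) ** t)
    - z ** (y ** (x ** t)) - ((x ** z) ** y) ** t.
  by apply: (lincomb1 (jordan_op x y z t)); jring.
by rewrite !(rpredB, rpredD).
Qed.

Lemma memv_opl_same (V : {vspace A}) x y t :
  ((x ** x) ** y) ** t \in V ->
  x ** ((x ** y) ** t) \in V -> y ** ((x ** x) ** t) \in V ->
  x ** (y ** (x ** t)) \in V.
Proof.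
move=> V1 V2 V3; apply: memv_mulr2n.
have -> : (x ** (y ** (x ** t))) *+ 2 = (x ** ((x ** y) ** t)) *+ 2 + y ** ((x ** x) ** t)
    - ((x ** x) ** y) ** t.
  by apply: (lincomb1 (jordan_op x y x t)); jring.
by rewrite mulr2n !(rpredB, rpredD).
Qed.

(** Nilpotency as a flag built one vector at a time, each member having its products in the previous
    one. *)
Inductive engel : {vspace A} -> Prop :=
| engel_zero : engel 0%VS
| engel_step (C : {vspace A}) w :
    engel C -> (forall u v, u \in (C + <[w]>)%VS -> v \in (C + <[w]>)%VS -> u ** v \in C) ->
    engel (C + <[w]>)%VS.

Lemma engel_stab B : engel B -> stabilizes B B.
Proof.
case=> [b v|C w _ Cw u v Bu Bv].
  by rewrite !memv0 => /eqP -> _; rewrite jmul0l.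
by apply: (subvP (addvSl _ _)); exact: Cw.
Qed.

Lemma memv_add_line (C V : {vspace A}) w v :
  (forall c, c \in C -> c ** v \in V) -> w ** v \in V ->
  forall b, b \in (C + <[w]>)%VS -> b ** v \in V.
Proof.
move=> CV wV b /memv_addP[c Cc [_ /vlineP[k ->] ->]].
by rewrite jmulDl jmulZl; apply: rpredD; [exact: CV | exact: rpredZ].
Qed.

(** Engel's theorem for [B] acting on the quotient of [V'] by [V]: the induction gives a vector
    killed by [C] modulo [V], which is moved until [w] kills it too. *)
Lemma engel_act B : engel B -> forall V V' : {vspace A}, (V <= V')%VS ->
  stabilizes B V -> stabilizes B V' -> ~~ (V' <= V)%VS ->
  exists v, [/\ v \in V', v \notin V & forall b, b \in B -> b ** v \in V].
Proof.
elim=> {B} [|C w engC IH Cw] V V' sVV' BV BV' /subvPn nV'V.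
  have [v V'v nVv] := nV'V; exists v; split=> // b.
  by rewrite memv0 => /eqP ->; rewrite jmul0l mem0v.
set B := (C + <[w]>)%VS in Cw BV BV' *.
have sCB c : c \in C -> c \in B by apply: subvP; exact: addvSl.
have Bw : w \in B by apply: subvP (memv_line w); exact: addvSr.
have [|||v [V'v nVv Cv]] := IH V V' sVV'; try by move=> c u /sCB; first [exact: BV | exact: BV'].
  by apply/subvPn.
have CC u u' : u \in C -> u' \in C -> u ** u' \in C by move=> /sCB Bu /sCB; exact: Cw.
have wC u : u \in C -> w ** u \in C by move=> /sCB; exact: Cw.
have Cw' u : u \in C -> u ** w \in C by move=> /sCB Bu; exact: Cw.
have killed u : u \in V' -> u \notin V -> (forall c, c \in C -> c ** u \in V) -> w ** u \in V ->
    exists u, [/\ u \in V', u \notin V & forall b, b \in B -> b ** u \in V].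
  by move=> *; exists u; split=> //; exact: memv_add_line.
have wV' u : u \in V' -> w ** u \in V' by exact: BV'.
have wV u : u \in V -> w ** u \in V by exact: BV.
have CV c u : c \in C -> u \in V -> c ** u \in V by move=> /sCB; exact: BV.
(* Either some [c (w u)] or the last [w^i v] outside [V] is killed by [B]. *)
have step u : u \in V' -> (forall c, c \in C -> c ** u \in V) ->
    (forall c, c \in C -> c ** (w ** u) \in V) \/
    exists u, [/\ u \in V', u \notin V & forall b, b \in B -> b ** u \in V].
  move=> V'u Cu; apply: NNPP => /not_or_and[nC none].
  have [c nc] := not_all_ex_not _ _ nC; have [Cc /negP nV] := imply_to_and _ _ nc.
  apply: none; apply: (killed (c ** (w ** u))) => //.
  - by auto.
  - move=> c' Cc'; apply: memv_opl; auto 8.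
  - apply: memv_opl_same; auto 8.
have [Cwv|//] := step v V'v Cv.
have [wvV|nwv] := boolP (w ** v \in V); first exact: (killed v).
have [Cwwv|//] := step _ (wV' _ V'v) Cwv.
(* [w ** w] and [(w ** w) ** w] lie in [C], which sends [v] into [V]. *)
have wwwv : w ** (w ** (w ** v)) \in V.
  by apply: memv_opl_same; auto 8.
have [wwvV|nwwv] := boolP (w ** (w ** v) \in V); first exact: (killed (w ** v) (wV' _ V'v)).
by apply: (killed (w ** (w ** v))) => //; rewrite !wV'.
Qed.

Lemma iter_sqrE x n : iter n (fun y => y ** y) x = jpow mul x (2 ^ n).-1.
Proof.
elim: n => //= n ->; rewrite (jpow_mul charF jordanA) expnS mul2n -addnn.
by case: (2 ^ n)%N (expn_gt0 2 n) => // m _; rewrite addSn addnS.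
Qed.

(** Repeated squaring brings the nil [x] into [B]; [y] is the last iterate outside. *)
Lemma sqr_descent (P : A -> Prop) (B : {vspace A}) x :
  P x -> x \notin B -> jnil mul x -> (forall y, P y -> y \notin B -> P (y ** y)) ->
  exists y, [/\ P y, y \notin B & y ** y \in B].
Proof.
move=> Px nBx [n xn0] Psqr.
have : iter n (fun y => y ** y) x \in B.
  rewrite iter_sqrE (jpow_eq0 _ xn0) ?mem0v //.
  by rewrite -ltnS prednK ?expn_gt0 // ltn_expl.
clear xn0; elim: n => [|n IH] in x Px nBx *; first by rewrite /= (negPf nBx).
rewrite iterSr => Bxn; have [Bxx|nBxx] := boolP (x ** x \in B); first by exists x.
by apply: (IH (x ** x)) => //; exact: Psqr.
Qed.

(* For [x] normalizing [B], either [x ** x] normalizes [B] too, or all the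
   [(x ** x) ** b + b'] do, and these are closed under squaring. *)
Lemma engel_normalizer S B : is_subalgebra mul S -> (forall x, x \in S -> jnil mul x) ->
  engel B -> (B <= S)%VS -> ~~ (S <= B)%VS ->
  exists y, [/\ y \in S, y \notin B, forall b, b \in B -> b ** y \in B & y ** y \in B].
Proof.
move=> algS nilS engB sBS nSB; apply: NNPP => none.
pose N y := y \in S /\ forall b, b \in B -> b ** y \in B.
(* By [sqr_descent] and [none], a family of normalizing elements that is stable under squaring lies
   in [B]. *)
have good P : (forall y, P y -> N y) -> (forall y, P y -> y \notin B -> P (y ** y)) ->
    forall y, P y -> y \in B.
  move=> PN Psqr y Py; apply/negPn/negP => nBy.
  have [|z [Pz nBz Bzz]] := sqr_descent Py nBy _ Psqr; first by apply: nilS; case: (PN y Py).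
  by apply: none; exists z; case: (PN z Pz).
have BB : forall b b', b \in B -> b' \in B -> b ** b' \in B := engel_stab engB.
have SS u v : u \in S -> v \in S -> u ** v \in S by exact: algS.
have BS b : b \in B -> b \in S by exact: subvP.
have [|x [Sx /negP nBx Nx]] := engel_act engB sBS BB _ nSB.
  by move=> b v /BS Sb Sv; exact: algS.
apply: nBx; apply: (good N) => // {Sx Nx} x [Sx Nx] nBx.
have xB b : b \in B -> x ** b \in B by move=> Bb; rewrite (jmulC jordanA) Nx.
have BBx b b' : b \in B -> b' \in B -> b ** (b' ** (x ** x)) \in B.
  by move=> Bb Bb'; apply: memv_opl; auto 8.
split=> [|b Bb]; first exact: algS.
pose P y := exists b b', [/\ b \in B, b' \in B & y = (x ** x) ** b + b'].
rewrite (jmulC jordanA) -[X in X \in _]addr0.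
apply: (good P); last by exists b, 0; rewrite mem0v.
  move=> _ [c [c' [Bc Bc' ->]]]; split=> [|d Bd]; first by apply: rpredD; auto.
  by rewrite jmulDr (jmulC jordanA (x ** x)); apply: rpredD; auto.
move=> _ [c [c' [Bc Bc' ->]]] _; set y := (x ** x) ** c.
have Ny d : d \in B -> d ** y \in B.
  by move=> Bd; rewrite /y (jmulC jordanA (x ** x)) BBx.
have xyE : x ** y = (x ** x) ** (x ** c) by rewrite /y (mul_sqr_comm jordanA).
have Bdxy d : d \in B -> d ** (x ** y) \in B.
  by move=> Bd; rewrite xyE (jmulC jordanA (x ** x)) BBx ?xB.
exists (c ** y), (y ** y - (x ** x) ** (c ** y) + (c' ** y) *+ 2 + c' ** c'); split.
- exact: Ny.
- rewrite mulr2n; apply: rpredD; last by auto.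
  apply: rpredD; last by apply: rpredD; auto.
  (* The difference between [y ** y] and [(x ** x) ** (c ** y)] is expressed through [x ** y], which
     [B] multiplies into [B]. *)
  have H1 := jordan_op x c x y; have H2 := jordan_lin charF jordanA x x c y.
  have -> : y ** y - (x ** x) ** (c ** y)
      = ((x ** c) ** (x ** y)) *+ 2 - (x ** (c ** (x ** y))) *+ 2.
    rewrite {1}/y.
    by apply: (lincomb2 H1 H2); jring.
  by rewrite !mulr2n !(rpredB, rpredD) //; auto 8.
- have -> : ((x ** x) ** c + c') ** ((x ** x) ** c + c') = y ** y + (c' ** y) *+ 2 + c' ** c'.
    by rewrite -/y; jring.
  by rewrite /y; jring.
Qed.

(** A normalizing [y] outside [B] extends the flag by one dimension inside [S], until [S] is
    reached. *)
Lemma engel_nil S : is_subalgebra mul S -> (forall x, x \in S -> jnil mul x) -> engel S.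
Proof.
move=> algS nilS.
have [n] := ubnP (\dim S); suff : forall B, engel B -> (B <= S)%VS ->
    (\dim S - \dim B < n)%N -> engel S.
  by move=> H lt_Sn; apply: (H _ engel_zero (sub0v _)); exact: leq_ltn_trans (leq_subr _ _) lt_Sn.
elim: n => // n IH B engB sBS ltn.
have [sSB|nSB] := boolP (S <= B)%VS.
  by have -> : S = B by apply/eqP; rewrite eqEsubv sSB.
have [y [Sy nBy Ny Byy]] := engel_normalizer algS nilS engB sBS nSB.
have BB : forall b b', b \in B -> b' \in B -> b ** b' \in B := engel_stab engB.
have sB'S : (B + <[y]> <= S)%VS by rewrite subv_add sBS -memvE.
apply: (IH (B + <[y]>)%VS _ sB'S).
  apply: engel_step engB _ => u v.
  move=> /memv_addP[b Bb [_ /vlineP[k ->] ->]] /memv_addP[c Bc [_ /vlineP[l ->] ->]].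
  rewrite jmulDl !jmulDr /= !jmulZl !jmulZr (jmulC jordanA y c).
  by do 2!apply: rpredD; rewrite ?rpredZ //; auto.
have ltBB' : (\dim B < \dim (B + <[y]>))%N.
  rewrite ltnNge; apply: contra nBy => le_dim.
  have /eqP -> : B == (B + <[y]>)%VS by rewrite eqEdim addvSl.
  by apply: subvP (memv_line y); exact: addvSr.
rewrite -ltnS (leq_trans _ ltn) //.
by rewrite ltnS ltn_sub2l // (leq_trans ltBB') ?dimvS.
Qed.

Lemma nil_annihilator S : is_subalgebra mul S -> (forall x, x \in S -> jnil mul x) ->
  S != 0%VS -> exists z, [/\ z \in S, z != 0 & forall s, s \in S -> s ** z = 0].
Proof.
move=> algS nilS S0.
have [|||z [Sz z0 zS]] := engel_act (engel_nil algS nilS) (sub0v S).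
- by move=> b v _ /[!memv0] /eqP ->; rewrite jmul0r.
- exact: algS.
- by rewrite subv0.
by exists z; split=> [||s /zS /[!memv0] /eqP] //; rewrite -memv0.
Qed.

End Engel.

(** * Algebras with no proper idempotent *)

Section LocalAlgebras.

Variables (F : fieldType) (charF : 2%N \notin [pchar F]).
Variables (A : vectType F) (mul : {bilinear A -> A -> A}).
Hypothesis jordanA : is_jordan mul.

Local Notation "x ** y" := (mul x y) (at level 40, left associativity).
Implicit Types (x y z w t u v : A).
Local Ltac jring := rewrite /jUU /jU /jV; nring mul (jmulC jordanA).

Lemma jpow_jev x p m : jpow mul (jev mul x p) m = jev mul x (p ^+ m.+1 * 'X^m).
Proof.
elim: m => [|m IH]; first by rewrite expr1 expr0 mulr1.
rewrite jpowS IH (jev_mul charF jordanA); congr jev.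
by rewrite [p ^+ m.+2]exprS ['X^(m.+1)]exprSr !mulrA.
Qed.

Lemma jev_dvdXn x p n m : jpow mul x n = 0 -> (n <= m)%N -> jev mul x (p * 'X^m) = 0.
Proof.
by move=> x0 le_nm; apply: jev_dvd; rewrite jev_Xn; exact: jpow_eq0 le_nm x0.
Qed.

Lemma jnil_jev x p : jnil mul x -> jnil mul (jev mul x p).
Proof. by case=> n x0; exists n; rewrite jpow_jev (jev_dvdXn _ x0). Qed.

Lemma jpowZ c x n : jpow mul (c *: x) n = c ^+ n.+1 *: jpow mul x n.
Proof.
elim: n => [|n IH]; first by rewrite expr1.
by rewrite !jpowS IH jmulZl jmulZr scalerA -exprS.
Qed.

Lemma jnilZ c x : jnil mul x -> jnil mul (c *: x).
Proof. by case=> n x0; exists n; rewrite jpowZ x0 scaler0. Qed.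

Lemma jU_jev x p : jU mul x (jev mul x p) = jev mul x (p * 'X^2).
Proof.
rewrite /jU -!jev_mulX.
have -> : x ** x = jev mul x 'X by rewrite -(expr1 'X) jev_Xn.
rewrite (jev_mul charF jordanA) -linearMn -linearB /=; congr jev.
by rewrite mulr2n; ring.
Qed.

Lemma jUDr x u v : jU mul x (u + v) = jU mul x u + jU mul x v.
Proof. jring. Qed.

Lemma jU0r x : jU mul x 0 = 0.
Proof. jring. Qed.

Hypothesis closedF : forall p : {poly F}, size p != 1 -> exists a, root p a.

(** Linear factors are stripped from an annihilating polynomial until the cofactor [q] no longer
    kills [u]; the last root is the eigenvalue. *)
Lemma jev_eigenvector u :
  u = 0 \/ exists c q, jev mul u q != 0 /\ u ** jev mul u q = c *: jev mul u q.
Proof.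
have [p p0 up] := annihilating_poly mul u.
have [n] := ubnP (size p); elim: n p p0 up => // n IH p p0 up lt_pn.
have [/eqP/size_poly1P[c c0 pE]|sz] := eqVneq (size p) 1.
  by left; apply/eqP; move: up => /eqP; rewrite pE jevC scaler_eq0 (negPf c0).
have [a /factor_theorem[q pE]] := closedF sz.
have q0 : q != 0 by apply: contraNneq p0 => q0; rewrite pE q0 mul0r.
have [uq|uq] := eqVneq (jev mul u q) 0.
  apply: (IH q) => //; rewrite -ltnS (leq_trans _ lt_pn) // ltnS pE.
  by rewrite size_mul ?polyXsubC_eq0 // size_XsubC addn2 ltnS.
right; exists a, q; split=> //; apply/eqP; rewrite -subr_eq0 -up pE mulrBr linearB /= jev_mulX.
by rewrite [q * _]mulrC mul_polyC [jev mul u (_ *: _)]linearZ.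
Qed.

Section Local.

Variables (S : {vspace A}) (e : A).
Hypotheses (algS : is_subalgebra mul S) (Se : e \in S) (e0 : e != 0).
Hypothesis eS : forall x, x \in S -> e ** x = x.
Hypothesis idemS : forall f, f \in S -> f ** f = f -> f = 0 \/ f = e.

(** Since [jev mul u g] is [g * 'X] evaluated at [u], the value of [g] at [u] is the inverse of
    [u]. *)
Let invertible u := exists g, jev mul u g = e.

Let See : e ** e = e. Proof. exact: eS. Qed.

Let Se_r x : x \in S -> x ** e = x.
Proof. by move=> Sx; rewrite (jmulC jordanA) eS. Qed.

Lemma jpow_mem x n : x \in S -> jpow mul x n \in S.
Proof. by move=> Sx; elim: n => //= n IH; exact: algS. Qed.

Lemma jev_mem x p : x \in S -> jev mul x p \in S.
Proof. by move=> Sx; apply: memv_suml => i _; apply: memvZ; exact: jpow_mem. Qed.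

Lemma jU_mem x t : x \in S -> t \in S -> jU mul x t \in S.
Proof. by move=> Sx St; rewrite /jU memvB ?mulr2n ?memvD ?algS ?algS. Qed.

Let jnil_or_inv u : u \in S -> jnil mul u \/ invertible u.
Proof.
move=> Su; have [|[g [g0 gg]]] := jnil_or_idempotent charF jordanA u; first by left.
right; exists g; have [gE|//] := idemS (jev_mem g Su) gg.
by rewrite gE eqxx in g0.
Qed.

Let inv_not_nil u : jnil mul u -> invertible u -> False.
Proof.
move=> [n un] [g ge]; case/eqP: e0.
have eE : forall m, jpow mul e m = e by elim=> //= m ->.
by rewrite -(eE n) -ge jpow_jev (jev_dvdXn _ un).
Qed.

Let jU_e t : t \in S -> jU mul e t = t.
Proof. by move=> St; rewrite /jU See !eS // mulr2n addrK. Qed.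

(** [q] is the inverse square of [u], so [jU u q = e], and the fundamental formula turns the
    composite into [jU e], the identity on [S]. *)
Let inv_jU u : u \in S -> invertible u ->
  exists2 q, q \in S & forall t, t \in S -> jU mul u (jU mul q (jU mul u t)) = t.
Proof.
move=> Su [g ge]; exists (jev mul u (g ^+ 3)); first exact: jev_mem.
move=> t St; rewrite -jU_fundamental // jU_jev.
have -> : jev mul u (g ^+ 3 * 'X^2) = e.
  by rewrite -[RHS]See -{1}See -ge !(jev_mul charF jordanA); congr jev; ring.
exact: jU_e.
Qed.

Let inv_jU_inj u t : u \in S -> invertible u -> t \in S -> jU mul u t = 0 -> t = 0.
Proof.
move=> Su /(inv_jU Su)[q _ H] St t0.
by rewrite -(H t St) t0 !jU0r.
Qed.

Let nil_jU n : n \in S -> jnil mul n -> exists p, [/\ p \in S, p != 0 & jU mul n p = 0].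
Proof.
move=> Sn [k nk]; have [->|n0] := eqVneq n 0.
  by exists e; rewrite /jU !jmul0l mul0rn subr0.
have [m [m0 m1]] : exists m, jpow mul n m != 0 /\ jpow mul n m.+1 = 0.
  elim: k nk => [/eqP|k IH nk]; first by rewrite (negPf n0).
  by have [/IH//|mk] := eqVneq (jpow mul n k) 0; exists k.
exists (jpow mul n m); split=> //; first exact: jpow_mem.
have np : n ** jpow mul n m = 0 by [].
rewrite /jU np jmul0r mul0rn sub0r -[n ** n]/(jpow mul n 1) (jpow_mul charF jordanA).
by rewrite (jpow_eq0 _ m1) ?oppr0 // add1n.
Qed.

(** Otherwise [jU v n] is invertible and [U_v U_n U_v] injective on [S]; but [U_n] kills some
    [p != 0], which is in the image of [U_v]. *)
Let nil_jU_inv v n : v \in S -> invertible v -> n \in S -> jnil mul n -> jnil mul (jU mul v n).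
Proof.
move=> Sv iv Sn nn; have [//|iU] := jnil_or_inv (jU_mem Sv Sn).
have [q Sq qK] := inv_jU Sv iv; have [p [Sp p0 np]] := nil_jU Sn nn.
have Sr : jU mul q (jU mul v p) \in S by rewrite !jU_mem.
have r0 : jU mul q (jU mul v p) = 0.
  apply: (inv_jU_inj (jU_mem Sv Sn) iU Sr).
  by rewrite jU_fundamental // qK // np jU0r.
by case/eqP: p0; rewrite -(qK p Sp) r0 jU0r.
Qed.

(** The powers of [m = e - n] are [e] plus a polynomial in [n]; as one vanishes, the nil [n] would
    be invertible. *)
Let nil_add_unit n m : n \in S -> jnil mul n -> jnil mul m -> n + m = e -> False.
Proof.
move=> Sn nn [j mj] nme; have mE : m = e - n by rewrite -nme addrC addKr.
suff [p pE] : exists p, jpow mul m j = e + jev mul n p.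
  apply: (@inv_not_nil n nn); exists (- p); rewrite linearN /=.
  by apply/eqP; rewrite eq_sym -addr_eq0 -pE mj.
elim: j {mj} => [|j [p IH]] /=.
  by exists (-1); rewrite mE linearN /= -(expr0 'X) jev_Xn.
exists (p - 1 - p * 'X); rewrite IH mE !linearB /= jev_mulX -(expr0 'X) jev_Xn [jpow _ _ 0]/=.
have eP := eS (jev_mem p Sn); set P := jev mul n p in eP *.
have H : forall a b c d : A, a = b -> c = d -> a - c = b - d by move=> ? ? ? ? -> ->.
by apply: (lincomb2 See (H _ _ _ _ eP (eS Sn))); jring.
Qed.

(* With [v = e - h], [U_v] maps [e + 2 h] to [e - 3 h^2 + 2 h^3]: one step of
   Newton's iteration for the inverse square root. *)
Let jU_newton h : h \in S ->
  jU mul (e - h) (e + h *+ 2) = e + (h ** (h ** h) *+ 2 - (h ** h) *+ 3).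
Proof.
move=> Sh; have Shh : h ** h \in S by exact: algS.
have H3 : forall a b c d f g : A, a = b -> c = d -> f = g -> a + c - f = b + d - g.
  by move=> ? ? ? ? ? ? -> -> ->.
have E1 : (e - h) ** (e + h *+ 2) = e + h - (h ** h) *+ 2.
  by apply: (lincomb2 See (eS Sh)); jring.
have E2 : (e - h) ** (e + h - (h ** h) *+ 2) = e - (h ** h) *+ 3 + (h ** (h ** h)) *+ 2.
  have E2' := congr1 (fun u => u *+ 2) (eS Shh).
  by apply: (lincomb1 (H3 _ _ _ _ _ _ See (erefl h) E2')); jring.
have E3 : (e - h) ** (e - h) = e - h *+ 2 + h ** h.
  by apply: (lincomb1 (H3 _ _ _ _ _ _ See (erefl h) (congr1 (fun u => u *+ 2) (eS Sh)))); jring.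
have E4 : (e - h *+ 2 + h ** h) ** (e + h *+ 2) = e - (h ** h) *+ 3 + (h ** (h ** h)) *+ 2.
  by apply: (lincomb2 See (eS Shh)); jring.
rewrite /jU E1 E2 E3 E4 mulr2n addrK -addrA; congr (_ + _); exact: addrC.
Qed.

(** Applying [U_(e - h)] keeps both summands nil and doubles the order of the error [h]; after [k]
    Newton steps the error is 0 and [nil_add_unit] applies. *)
Let nil_add_unipotent k n m h : n \in S -> m \in S -> h \in S ->
  jnil mul n -> jnil mul m -> jpow mul h (2 ^ k).-1 = 0 -> n + m = e + h *+ 2 -> False.
Proof.
elim: k n m h => [|k IH] n m h Sn Sm Sh nn nm hk nmE.
  by apply: (nil_add_unit Sn nn nm); rewrite nmE [h]hk mul0rn addr0.
have nh : jnil mul h by exists (2 ^ k.+1).-1.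
have Sv : e - h \in S by rewrite memvB.
have [nv|iv] := jnil_or_inv Sv.
  by apply: (nil_add_unit Sh nh nv); rewrite addrC subrK.
(* [jev] supplies one more factor ['X]: [h'] is [h^3 - (3/2) h^2], half of the error term in
   [jU_newton]. *)
pose h' := jev mul h ('X * ('X - (3 / 2)%:P)).
apply: (IH (jU mul (e - h) n) (jU mul (e - h) m) h'); rewrite ?jU_mem ?jev_mem //.
- exact: nil_jU_inv.
- exact: nil_jU_inv.
- rewrite jpow_jev exprMn mulrC mulrA -exprD mulrC (jev_dvdXn _ hk) //.
  rewrite expnS mul2n -addnn prednK ?expn_gt0 //.
  by case: (2 ^ k)%N (expn_gt0 2 k).
rewrite -jUDr nmE jU_newton //; congr (_ + _).
rewrite /h' mulrBr linearB /= mulrnBl; congr (_ - _).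
  by rewrite -expr2 jev_Xn.
rewrite mulrC mul_polyC linearZ /= -(expr1 'X) jev_Xn /= -!scaler_nat scalerA; congr (_ *: _).
by rewrite mulrC mulfVK // two_neq0.
Qed.

(** For an eigenvalue [c] of multiplication by [u] on the polynomials in [u], [U_(u - c e)] kills
    the eigenvector, so [u - c e] is not invertible, hence nil. *)
Lemma local_eigenvalue u : u \in S -> exists c, jnil mul (u - c *: e).
Proof.
move=> Su; have [->|[a [q [uq uqE]]]] := jev_eigenvector u.
  by exists 0; exists 0; rewrite scale0r subr0.
exists a; set t := u - _.
have St : t \in S by rewrite memvB ?memvZ.
have [//|it] := jnil_or_inv St.
have jevt r : t ** jev mul u r = jev mul u (r * ('X - a%:P)).
  rewrite mulrBr linearB /= jev_mulX /t jmulDl -scaleNr jmulZl eS ?jev_mem //.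
  by rewrite scaleNr [r * _]mulrC mul_polyC [in RHS]linearZ.
have ts : t ** jev mul u q = 0.
  by rewrite jevt mulrBr linearB /= jev_mulX uqE [q * _]mulrC mul_polyC linearZ subrr.
case/eqP: uq; apply: (inv_jU_inj St it); rewrite ?jev_mem // /jU ts jmul0r mul0rn sub0r.
have tt : t ** t = jev mul u ('X - (a *+ 2)%:P) + a ^+ 2 *: e.
  have u1 : jev mul u 1 = u by rewrite -(expr0 'X) jev_Xn.
  have tu : t ** u = jev mul u ('X - a%:P) by rewrite -{1}u1 jevt mul1r.
  rewrite {2}/t -scaleNr jmulDr jmulZr Se_r // tu /t scalerBr scalerA mulNr !scaleNr.
  rewrite opprK -expr2 addrA; congr (_ + _).
  by rewrite -scaleNr -(jevC mul) -linearD; congr jev; rewrite polyCN polyCMn mulr2n opprD addrA.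
rewrite tt jmulDl jmulZl eS ?jev_mem // (jev_mul charF jordanA) -linearZ -linearD /=.
have -> : ('X - (a *+ 2)%:P) * q * 'X + a ^+ 2 *: q = ('X - a%:P) * (q * ('X - a%:P)).
  rewrite -mul_polyC polyCMn rmorphXn /=; ring.
by rewrite jev_dvd ?oppr0 // -jevt.
Qed.

Lemma local_nil_add n m : n \in S -> m \in S -> jnil mul n -> jnil mul m -> jnil mul (n + m).
Proof.
move=> Sn Sm nn nm; have Su : n + m \in S by rewrite memvD.
have [c uc] := local_eigenvalue Su.
have [c0|c0] := eqVneq c 0; first by rewrite c0 scale0r subr0 in uc.
(* For [c != 0], division by [c] writes [e + h *+ 2], with [h] nil, as a sum of two nilpotents. *)
pose h := (2 * c)^-1 *: (n + m - c *: e).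
have [k hk] : jnil mul h by exact: jnilZ.
have Sh : h \in S by apply: memvZ; apply: memvB => //; exact: memvZ.
have {}hk : jpow mul h (2 ^ k).-1 = 0.
  by apply: jpow_eq0 hk; rewrite -ltnS prednK ?expn_gt0 // ltn_expl.
apply: False_ind.
apply: (nil_add_unipotent (memvZ c^-1 Sn) (memvZ c^-1 Sm) Sh (jnilZ _ nn) (jnilZ _ nm) hk).
have n2 : 2 != 0 :> F := two_neq0 charF.
have cc : 2 * (2 * c)^-1 = c^-1.
  by rewrite invfM mulrA (mulfV n2) mul1r.
have -> : h *+ 2 = c^-1 *: (n + m) - e.
  by rewrite -scaler_nat /h scalerA cc scalerBr scalerA mulVf // scale1r.
by rewrite [e + _]addrC subrK scalerDr.
Qed.

End Local.

End LocalAlgebras.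

(** * Peirce decomposition *)

Section PeirceDecomposition.

Variables (F : fieldType) (charF : 2%N \notin [pchar F]).
Variables (A : vectType F) (mul : {bilinear A -> A -> A}).
Hypothesis jordanA : is_jordan mul.

Local Notation "x ** y" := (mul x y) (at level 40, left associativity).
Implicit Types (x y z w t u v : A).
Local Ltac jring := rewrite /jUU /jU /jV; nring mul (jmulC jordanA).

(** A subspace inside [P] is enlarged by any missing element of [P], and finite dimension stops
    this. *)
Lemma vspace_of_closed (P : A -> Prop) : P 0 -> (forall x y, P x -> P y -> P (x + y)) ->
  (forall c x, P x -> P (c *: x)) -> exists W : {vspace A}, forall x, x \in W <-> P x.
Proof.
move=> P0 PD PZ.
suff : forall n (W : {vspace A}), (forall x, x \in W -> P x) -> (\dim {:A} - \dim W < n)%N ->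
    exists W : {vspace A}, forall x, x \in W <-> P x.
  by move=> /(_ _ 0%VS); apply; [move=> x; rewrite memv0 => /eqP-> | exact: leqnn].
elim=> // n IH W WP ltn.
case: (classic (forall x, P x -> x \in W)) => [PW|nPW].
  by exists W => x; split; auto.
have [x nx] := not_all_ex_not _ _ nPW; have [Px /negP nWx] := imply_to_and _ _ nx.
apply: (IH (W + <[x]>)%VS).
  by move=> _ /memv_addP[u Wu [_ /vlineP[k ->] ->]]; apply: PD; auto.
have ltWW' : (\dim W < \dim (W + <[x]>))%N.
  rewrite ltnNge; apply: contra nWx => le_dim.
  have /eqP -> : W == (W + <[x]>)%VS by rewrite eqEdim addvSl.
  by apply: subvP (memv_line x); exact: addvSr.
rewrite -ltnS (leq_trans _ ltn) //.
by rewrite ltnS ltn_sub2l // (leq_trans ltWW') ?dimvS ?subvf.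
Qed.

(** The fundamental formula with a unit in the middle, obtained here without a unit from [jV_sqr]
    with equal arguments. *)
Lemma jU_sqr x t : jU mul (x ** x) t = jU mul x (jU mul x t).
Proof.
apply: (mulr2n_inj charF).
have c3 := jpow_comm charF jordanA x 2 t; have p3 := jpow_mul charF jordanA x 1 1.
rewrite /= in c3 p3; have p3t := congr1 (fun u => (u ** t) *+ 2) p3.
have H : forall a b c d f g : A, a = b -> c = d -> f = g -> a + c *+ 2 - f = b + d *+ 2 - g.
  by move=> ? ? ? ? ? ? -> -> ->.
apply: (lincomb1 (H _ _ _ _ _ _ (jV_sqr charF jordanA x x t) c3 p3t)); jring.
Qed.

Definition peirce e c : {vspace A} := lker (linfun (mul e) - c *: \1)%VF.

Lemma mem_peirce e c x : (x \in peirce e c) = (e ** x == c *: x).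
Proof. by rewrite memv_ker add_lfunE opp_lfunE scale_lfunE id_lfunE lfunE subr_eq0. Qed.

Section Peirce.

Variable e : A.
Hypothesis ee : e ** e = e.

(** Multiplication by [e] is a root of [t (t - 1) (2 t - 1)], whence the eigenvalues 0, 1/2 and
    1. *)
Lemma peirce_cubic x : (e ** (e ** (e ** x))) *+ 2 + e ** x = (e ** (e ** x)) *+ 3.
Proof.
have H := jordan_op charF jordanA e e e x; rewrite !ee in H.
by apply: (lincomb1 H); jring.
Qed.

Lemma peirce_decomp x : exists x1 xh x0,
  [/\ x = x1 + xh + x0, e ** x1 = x1, (e ** xh) *+ 2 = xh & e ** x0 = 0].
Proof.
(* The Lagrange interpolation polynomials at 1, 1/2 and 0, evaluated at multiplication by [e]. *)
exists ((e ** (e ** x)) *+ 2 - e ** x), ((e ** x) *+ 4 - (e ** (e ** x)) *+ 4),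
  (x - (e ** x) *+ 3 + (e ** (e ** x)) *+ 2).
have H2 : forall u v : A, u = v -> u *+ 4 = v *+ 4 by move=> ? ? ->.
split.
- jring.
- by apply: (lincomb1 (peirce_cubic x)); jring.
- by apply: (lincomb1 (H2 _ _ (esym (peirce_cubic x)))); jring.
- by apply: (lincomb1 (peirce_cubic x)); jring.
Qed.

Lemma peirce1_comm x t : e ** x = x -> e ** (x ** t) = x ** (e ** t).
Proof.
move=> ex; have H := jordan_lin charF jordanA e e x t; rewrite ee ex in H.
by apply: (lincomb1 H); jring.
Qed.

Lemma peirce0_comm x t : e ** x = 0 -> e ** (x ** t) = x ** (e ** t).
Proof.
move=> ex; have H := jordan_lin charF jordanA e e x t; rewrite ee ex in H.
by apply: (lincomb1 (esym H)); jring.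
Qed.

Lemma peirce1_mul x z : e ** x = x -> e ** z = z -> e ** (x ** z) = x ** z.
Proof. by move=> ex ez; rewrite peirce1_comm // ez. Qed.

Lemma peirce0_mul x z : e ** x = 0 -> e ** z = 0 -> e ** (x ** z) = 0.
Proof. by move=> ex ez; rewrite peirce0_comm // ez jmul0r. Qed.

(** Multiplication by [e] commutes with those by [x] and [z], so [e ** (x ** z)] is both 0 and
    [x ** z]. *)
Lemma peirce10_mul x z : e ** x = x -> e ** z = 0 -> x ** z = 0.
Proof.
move=> ex ez; have H := peirce1_comm z ex; rewrite ez jmul0r in H.
by rewrite -H (jmulC jordanA x z) (peirce0_comm x ez) ex (jmulC jordanA z x).
Qed.

Lemma peirce1h_mul x h : e ** x = x -> (e ** h) *+ 2 = h -> (e ** (x ** h)) *+ 2 = x ** h.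
Proof. by move=> ex eh; rewrite peirce1_comm // -linearMn /= eh. Qed.

Lemma peirce0h_mul x h : e ** x = 0 -> (e ** h) *+ 2 = h -> (e ** (x ** h)) *+ 2 = x ** h.
Proof. by move=> ex eh; rewrite peirce0_comm // -linearMn /= eh. Qed.

Lemma peirceh_mul h k : (e ** h) *+ 2 = h -> (e ** k) *+ 2 = k ->
  e ** (e ** (h ** k)) = e ** (h ** k).
Proof.
move=> eh ek; apply: (mulr2n_inj charF); apply: (mulr2n_inj charF).
have H := jordan_lin charF jordanA e h k e; rewrite ee in H.
have E1 : ((e ** h) ** e) ** k *+ 4 = h ** k.
  rewrite -[in RHS]eh -{2}eh; jring.
have E2 : ((e ** k) ** e) ** h *+ 4 = h ** k.
  rewrite -[in RHS]ek -{2}ek; jring.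
have E3 : (e ** h) ** (e ** k) *+ 4 = h ** k.
  rewrite -[in RHS]eh -[in RHS]ek; jring.
have H4 : forall a b c d f g u v : A, a = b -> c = d -> f = g -> u = v ->
   a *+ 4 - c - f + u *+ 2 = b *+ 4 - d - g + v *+ 2 by move=> ? ? ? ? ? ? ? ? -> -> -> ->.
apply: (lincomb1 (H4 _ _ _ _ _ _ _ _ H E1 E2 E3)); jring.
Qed.

(** Twice the multiplication is a Jordan homomorphism into the endomorphisms of the half space; [c]
    treats the 1-space and the 0-space together. *)
Lemma peirce_hom c x z h : e ** x = x *+ c -> e ** z = z *+ c -> e ** (x ** z) = (x ** z) *+ c ->
  c = 1%N \/ c = 0%N -> (e ** h) *+ 2 = h -> (x ** z) ** h = x ** (z ** h) + z ** (x ** h).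
Proof.
move=> ex ez exz c01 eh.
have exh : (e ** (x ** h)) *+ 2 = x ** h.
  by case: c01 ex => -> ex; [exact: peirce1h_mul | exact: peirce0h_mul].
have ezh : (e ** (z ** h)) *+ 2 = z ** h.
  by case: c01 ez => -> ez; [exact: peirce1h_mul | exact: peirce0h_mul].
have H := jordan_lin charF jordanA x z h e.
have E0 : (x ** z) ** (e ** h) *+ 2 = (x ** z) ** h by rewrite -[in RHS]eh; jring.
have E1 : ((x ** h) ** e) ** z *+ 2 = z ** (x ** h) by rewrite -[in RHS]exh; jring.
have E2 : ((z ** h) ** e) ** x *+ 2 = x ** (z ** h) by rewrite -[in RHS]ezh; jring.
have H4 : forall a b c d f g u v : A, a = b -> c = d -> f = g -> u = v ->
   a *+ 2 + c - f - u = b *+ 2 + d - g - v by move=> ? ? ? ? ? ? ? ? -> -> -> ->.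
have {H4} := H4 _ _ _ _ _ _ _ _ H E0 E1 E2.
rewrite !(jmulC jordanA _ e) ex ez exz; case: c01 => -> /= {ex ez exz E0 E1 E2 H exh ezh} H.
  by apply: (lincomb1 H); jring.
by apply: (lincomb1 (esym H)); jring.
Qed.

End Peirce.

(* Over a unital algebra this amounts to [U_z = 0]. *)
Definition absolute_zero_divisor z := z ** z = 0 /\ forall t, z ** (z ** t) = 0.

End PeirceDecomposition.

Lemma scalar_ext (F : fieldType) (A : vectType F) (u v : A) :
  (forall f : {scalar A}, f u = f v) -> u = v.
Proof.
move=> fuv; apply/eqP; rewrite -subr_eq0; apply/eqP.
rewrite (coord_vbasis (memvf (u - v))) big1 // => i _.
by have /= := fuv (coord (vbasis fullv) i); rewrite linearB /= => ->; rewrite subrr scale0r.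
Qed.

(** * Absolute zero divisors *)

Section UnitalHull.

Variables (F : fieldType) (charF : 2%N \notin [pchar F]).
Variables (A : vectType F) (mul : {bilinear A -> A -> A}).
Hypothesis jordanA : is_jordan mul.

Local Notation "x ** y" := (mul x y) (at level 40, left associativity).
Implicit Types (x y z w t u v : A).
Local Ltac jring := rewrite /jUU /jU /jV; nring mul (jmulC jordanA).

(** The unital hull of [A], with [(c, a)] standing for [c 1 + a]; it makes [U_(1 + x)] available. *)
Definition hull_mul (u v : (F^o * A)%type) : (F^o * A)%type :=
  (u.1 * v.1, (u.1 : F) *: v.2 + (v.1 : F) *: u.2 + u.2 ** v.2).

Lemma hull_mul_bilinear : bilinear_for *:%R *:%R hull_mul.
Proof.
have E1 (a b c d : F) x y z : (c * a + b) *: z + d *: (c *: x + y) + (c *: x + y) ** z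
    = c *: (a *: z + d *: x + x ** z) + (b *: z + d *: y + y ** z).
  apply: scalar_ext => f; rewrite jmulDl jmulZl !(linearD, linearZ) /=; ring.
have E2 (a b c d : F) x y z : d *: (c *: x + y) + (c * a + b) *: z + z ** (c *: x + y)
    = c *: (d *: x + a *: z + z ** x) + (d *: y + b *: z + z ** y).
  apply: scalar_ext => f; rewrite jmulDr jmulZr !(linearD, linearZ) /=; ring.
split=> [[d z] c [a x] [b y]|[d z] c [a x] [b y]].
  by congr (_, _); [rewrite /= mulrDl -scalerAl | exact: E1].
by congr (_, _); [rewrite /= mulrDr -scalerAr | exact: E2].
Qed.

HB.instance Definition _ := bilinear_isBilinear.Build F (F^o * A)%type (F^o * A)%type
  (F^o * A)%type *:%R *:%R hull_mul hull_mul_bilinear.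

Lemma hull_jordan : is_jordan hull_mul.
Proof.
have E (c d : F) a b :
    (c * c * d) *: a + c *: ((c * c) *: b + d *: (c *: a + c *: a + a ** a)
      + (c *: a + c *: a + a ** a) ** b)
    + ((c * c) *: b + d *: (c *: a + c *: a + a ** a) + (c *: a + c *: a + a ** a) ** b) ** a
  = (c * c) *: (d *: a + c *: b + b ** a) + (d * c) *: (c *: a + c *: a + a ** a)
    + (c *: a + c *: a + a ** a) ** (d *: a + c *: b + b ** a).
  have H1 := jordanA.2 a b; have H2 := jmulC jordanA (a ** b) a; have H3 := jmulC jordanA b a.
  rewrite !(jmulDl, jmulDr, jmulZl, jmulZr) H1 H3 H2.
  apply: scalar_ext => f; rewrite !(linearD, linearZ) /=; ring.
split=> [[a x] [b y]|[c a] [d b]].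
  congr (_, _); first exact: mulrC.
  by rewrite /= (jmulC jordanA y); congr (_ + _); exact: addrC.
congr (_, _); last exact: E.
by rewrite /= -!mulrA; congr (_ * _); rewrite mulrCA.
Qed.

Lemma hull_jU (c : F) a z : jU hull_mul (c, a) (0, z)
  = (0, c ^+ 2 *: z + (2 * c) *: (a ** z) + jU mul a z).
Proof.
pose p := c *: (c *: z + 0 *: a + a ** z) + (c * 0) *: a + a ** (c *: z + 0 *: a + a ** z).
pose q := (c * c) *: z + 0 *: (c *: a + c *: a + a ** a) + (c *: a + c *: a + a ** a) ** z.
have -> : jU hull_mul (c, a) (0, z) = (c * (c * 0) + c * (c * 0) - c * c * 0, p + p - q) by [].
congr (_, _); first by ring.
rewrite /p /q /jU !(jmulDl, jmulDr, jmulZl, jmulZr).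
apply: scalar_ext => f; rewrite !(linearD, linearZ, linearN, linearMn) /=; ring.
Qed.

Lemma hull_jU0 z (d : F) s :
  jU hull_mul (0, z) (d, s) = (0, d *: (z ** z) + (z ** (z ** s)) *+ 2 - (z ** z) ** s).
Proof.
pose r := 0 *: s + d *: z + z ** s; pose m := 0 *: z + 0 *: z + z ** z.
pose p := 0 *: r + (0 * d) *: z + z ** r; pose q := (0 * 0) *: s + d *: m + m ** s.
have -> : jU hull_mul (0, z) (d, s) = (0 * (0 * d) + 0 * (0 * d) - 0 * 0 * d, p + p - q) by [].
congr (_, _); first by ring.
rewrite /p /q /r /m !(mul0r, scale0r, add0r) jmulDr jmulZr.
apply: scalar_ext => f; rewrite !(linearD, linearZ, linearN, linearMn) /=; ring.
Qed.

(** The vector is [w = U_(c 1 + a) z]. As [U_z = 0] on the hull, the fundamental formula gives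
    [U_w = 0]; its values at the unit and at [t] are the two conditions. *)
Lemma azd_jU_hull (c : F) a z : absolute_zero_divisor mul z ->
  absolute_zero_divisor mul (c ^+ 2 *: z + (2 * c) *: (a ** z) + jU mul a z).
Proof.
move=> [zz zzt]; rewrite /absolute_zero_divisor; have := hull_jU c a z.
set w := _ + _ + jU mul a z => wE.
have hz (t : (F^o * A)%type) : jU hull_mul (0, z) t = 0.
  by case: t => d s; rewrite hull_jU0 zz zzt scaler0 mul0rn add0r jmul0l subr0.
have hw d s : d *: (w ** w) + (w ** (w ** s)) *+ 2 - (w ** w) ** s = 0.
  have := hull_jU0 w d s; rewrite -wE (jU_fundamental charF hull_jordan) hz (jU0r hull_jordan).
  by move/(congr1 snd).
have ww : w ** w = 0.
  by have := hw 1 0; rewrite !jmul0r mul0rn addr0 subr0 scale1r.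
split=> // t; have := hw 0 t; rewrite ww scaler0 jmul0l subr0 add0r => w2.
by apply: (mulr2n_inj charF); rewrite w2 mul0rn.
Qed.

Lemma azd_jU a z : absolute_zero_divisor mul z -> absolute_zero_divisor mul (jU mul a z).
Proof.
by move/(@azd_jU_hull 0 a); rewrite expr0n /= mulr0 !scale0r !add0r.
Qed.

End UnitalHull.

(** * Simple algebras *)

Section Simple.

Variables (F : fieldType) (charF : 2%N \notin [pchar F]).
Variables (A : vectType F) (mul : {bilinear A -> A -> A}).
Hypothesis jordanA : is_jordan mul.

Local Notation "x ** y" := (mul x y) (at level 40, left associativity).
Implicit Types (x y z w t u v : A).
Local Ltac jring := rewrite /jUU /jU /jV; nring mul (jmulC jordanA).

Hypothesis closedF : forall p : {poly F}, size p != 1 -> exists a, root p a.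
Hypothesis nontrivA : exists x y, x ** y != 0.
Hypothesis simpleA : forall P : A -> Prop, P 0 -> (forall x y, P x -> P y -> P (x + y)) ->
  (forall c x, P x -> P (c *: x)) -> (forall x y, P y -> P (x ** y)) ->
  (forall x, P x -> x = 0) \/ (forall x, P x).

Let ideal_cases (P : A -> Prop) x : P 0 -> (forall x y, P x -> P y -> P (x + y)) ->
  (forall c x, P x -> P (c *: x)) -> (forall x y, P y -> P (x ** y)) ->
  P x -> x = 0 \/ forall x, P x.
Proof. by move=> P0 PD PZ PM Px; case: (simpleA P0 PD PZ PM) => H; [left; exact: H | right]. Qed.

Lemma ex_argmin (T : Type) (P : T -> Prop) (m : T -> nat) : (exists i, P i) ->
  exists i, P i /\ forall j, P j -> (m i <= m j)%N.
Proof.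
case=> i; move: i => x Px; have [n] := ubnP (m x); elim: n => // n IH in x Px * => lt_xn.
case: (classic (exists2 j, P j & (m j < m x)%N)) => [[y Py lt_yx]|none].
  by apply: (IH y) => //; rewrite -ltnS (leq_trans _ lt_xn).
exists x; split=> // y Py; rewrite leqNgt; apply/negP => lt_yx; apply: none; by exists y.
Qed.

(** * Idempotents of a simple algebra *)

Lemma peirce1_subalgebra e : e ** e = e -> is_subalgebra mul (peirce mul e 1).
Proof.
move=> ee x y; rewrite !mem_peirce !scale1r => /eqP ex /eqP ey.
by rewrite (peirce1_mul charF jordanA ee ex ey).
Qed.

Lemma peirce0_subalgebra e : e ** e = e -> is_subalgebra mul (peirce mul e 0).
Proof.
move=> ee x y; rewrite !mem_peirce !scale0r => /eqP ex /eqP ey.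
by rewrite (peirce0_mul charF jordanA ee ex ey).
Qed.

(** In a nil algebra the annihilator would be a nonzero ideal, hence everything, against
    [nontrivA]. *)
Lemma exists_idempotent : exists e, e != 0 /\ e ** e = e.
Proof.
case: (classic (exists x, ~ jnil mul x)) => [[x nx]|all_nil].
  by have [//|[g gP]] := jnil_or_idempotent charF jordanA x; exists (jev mul x g).
have algA : is_subalgebra mul fullv by move=> ? ? _ _; exact: memvf.
have nilA x : x \in fullv -> jnil mul x.
  by move=> _; apply: NNPP => nx; apply: all_nil; exists x.
have [x [y xy]] := nontrivA.
have A0 : fullv != 0%VS :> {vspace A}.
  by apply: contraNneq xy => A0; rewrite -memv0 -A0 memvf.
have [z [_ z0 zA]] := nil_annihilator charF jordanA algA nilA A0.
have [|||||/eqP|annA] := @ideal_cases (fun z => forall s, s ** z = 0) z.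
- by move=> s; rewrite jmul0r.
- by move=> u v u0 v0 s; rewrite jmulDr u0 v0 addr0.
- by move=> c u u0 s; rewrite jmulZr u0 scaler0.
- by move=> u v v0 s; rewrite v0 jmul0r.
- by move=> s; exact: zA (memvf s).
- by rewrite (negPf z0).
by rewrite annA eqxx in xy.
Qed.

(** The 1-space of [e] has minimal dimension and contains that of [f], so they coincide and
    [e = f ** e = f]. *)
Lemma primitive_idempotent : exists e, [/\ e != 0, e ** e = e &
  forall f, e ** f = f -> f ** f = f -> f = 0 \/ f = e].
Proof.
have [e [[e0 ee] min_e]] := ex_argmin (fun e => \dim (peirce mul e 1)) exists_idempotent.
exists e; split=> // f ef ff; have [->|f0] := eqVneq f 0; [by left | right].
have sfe : (peirce mul f 1 <= peirce mul e 1)%VS.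
  apply/subvP => x; rewrite !mem_peirce !scale1r => /eqP fx.
  have fg : f ** (e - f) = 0 by rewrite jmulBr ff (jmulC jordanA) ef subrr.
  have := peirce10_mul charF jordanA ff fx fg; rewrite (jmulC jordanA) jmulBl fx.
  by move/eqP; rewrite subr_eq0.
have : e \in peirce mul f 1.
  have /eqP -> : peirce mul f 1 == peirce mul e 1 by rewrite eqEdim sfe min_e.
  by rewrite mem_peirce ee scale1r.
by rewrite mem_peirce scale1r (jmulC jordanA) ef => /eqP.
Qed.

(** * Vanishing of absolute zero divisors and existence of the unit *)

Inductive azd_span : A -> Prop :=
| azd_span0 : azd_span 0
| azd_span_azd z : absolute_zero_divisor mul z -> azd_span z
| azd_spanD x y : azd_span x -> azd_span y -> azd_span (x + y)
| azd_spanZ c x : azd_span x -> azd_span (c *: x).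

(** Twice [x ** z] is [U_(1 + x) z - z - U_x z], a combination of absolute zero divisors when [z] is
    one. *)
Lemma azd_span_ideal x y : azd_span y -> azd_span (x ** y).
Proof.
elim=> {y} [|z zP|u v _ Pu _ Pv|c u _ Pu].
- by rewrite jmul0r; exact: azd_span0.
- have w1 := azd_jU_hull charF jordanA 1 x zP; have w2 := azd_jU charF jordanA x zP.
  have -> : x ** z = 2^-1 *: (1 ^+ 2 *: z + (2 * 1) *: (x ** z) + jU mul x z
      + (-1) *: z + (-1) *: jU mul x z).
    rewrite expr1n mulr1 scale1r !scaleN1r addrAC addrK addrAC subrr add0r.
    by rewrite scalerA (mulVf (two_neq0 charF)) scale1r.
  apply: azd_spanZ; apply: azd_spanD; first apply: azd_spanD.
  - exact: azd_span_azd.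
  - by apply: azd_spanZ; exact: azd_span_azd.
  - by apply: azd_spanZ; exact: azd_span_azd.
- by rewrite jmulDr; exact: azd_spanD.
- by rewrite jmulZr; exact: azd_spanZ.
Qed.

Lemma jU_peirce1 e x : e ** e = e -> e ** jU mul e x = jU mul e x.
Proof.
move=> ee; rewrite /jU ee; apply: (lincomb1 (peirce_cubic charF jordanA ee x)); jring.
Qed.

(* A sum of absolute zero divisors cannot be a primitive idempotent [e]: [U_e]
   would exhibit [e] as a sum of nilpotents of the local algebra [peirce mul e 1]. *)
Lemma no_azd z : absolute_zero_divisor mul z -> z = 0.
Proof.
move=> zP; have [|||||//|spanA] := @ideal_cases azd_span z.
- exact: azd_span0.
- exact: azd_spanD.
- exact: azd_spanZ.
- exact: azd_span_ideal.
- exact: azd_span_azd.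
have [e [e0 ee prim_e]] := primitive_idempotent.
have algS := peirce1_subalgebra ee.
have Se : e \in peirce mul e 1 by rewrite mem_peirce ee scale1r.
have eS x : x \in peirce mul e 1 -> e ** x = x.
  by rewrite mem_peirce scale1r => /eqP.
have idemS f : f \in peirce mul e 1 -> f ** f = f -> f = 0 \/ f = e.
  by move/eS; exact: prim_e.
have SU x : jU mul e x \in peirce mul e 1.
  by rewrite mem_peirce scale1r jU_peirce1.
have nilU x : azd_span x -> jnil mul (jU mul e x).
  elim=> {x} [|w wP|u v _ nu _ nv|c u _ nu].
  - by rewrite (jU0r jordanA); exists 0.
  - by exists 1; case: (azd_jU charF jordanA e wP).
  - rewrite (jUDr jordanA).
    exact: (local_nil_add charF jordanA closedF algS Se e0 eS idemS).
  - have -> : jU mul e (c *: u) = c *: jU mul e u.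
      by rewrite /jU !jmulZr scalerMnr scalerBr.
    exact: jnilZ.
have [n] := nilU e (spanA e).
have -> : jU mul e e = e by rewrite /jU !ee mulr2n addrK.
have -> : jpow mul e n = e by elim: n => //= n ->.
by move/eqP; rewrite (negPf e0).
Qed.

Lemma exists_unit : exists e, e != 0 /\ forall x, e ** x = x.
Proof.
have [e [[e0 ee] min_e]] := ex_argmin (fun e => \dim (peirce mul e 0)) exists_idempotent.
exists e; split=> //.
(* The 0-space of [e + f] would lie in that of [e] and miss [f], against minimality. *)
have no_idem f : e ** f = 0 -> f ** f = f -> f = 0.
  move=> ef ff; apply/eqP/negPn/negP => f0.
  have efef : (e + f) ** (e + f) = e + f.
    by rewrite !jmulDl !jmulDr ee ff (jmulC jordanA f) ef addr0 add0r.
  have efe : (e + f) ** e = e by rewrite jmulDl ee (jmulC jordanA f) ef addr0.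
  have eff : (e + f) ** f = f by rewrite jmulDl ff ef add0r.
  have ef0 : e + f != 0 by apply: contraNneq e0 => ef0; rewrite -efe ef0 jmul0l.
  have sub : (peirce mul (e + f) 0 <= peirce mul e 0)%VS.
    apply/subvP => x; rewrite !mem_peirce !scale0r => /eqP efx.
    by rewrite (peirce10_mul charF jordanA efef efe efx).
  have : f \in peirce mul (e + f) 0.
    have /eqP -> : peirce mul (e + f) 0 == peirce mul e 0 by rewrite eqEdim sub min_e.
    by rewrite mem_peirce ef scale0r.
  by rewrite mem_peirce eff scale0r (negPf f0).
have mem0 x : x \in peirce mul e 0 <-> e ** x = 0.
  by rewrite mem_peirce scale0r; split=> /eqP.
have peirce0_eq0 x : e ** x = 0 -> x = 0.
  move=> /mem0 Sx; apply/eqP/negPn/negP => x0.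
  have S0 : peirce mul e 0 != 0%VS by apply: contraNneq x0 => S0; rewrite -memv0 -S0.
  have nilS y : y \in peirce mul e 0 -> jnil mul y.
    move=> Sy; have [//|[g [g0 gg]]] := jnil_or_idempotent charF jordanA y.
    case/eqP: g0; apply: no_idem => //; apply/mem0.
    by apply: jev_mem Sy; exact: peirce0_subalgebra.
  have [z [/mem0 ez z0 zS]] := nil_annihilator charF jordanA (peirce0_subalgebra ee) nilS S0.
  have zz : z ** z = 0 by apply: zS; exact/mem0.
  case/eqP: z0; apply: no_azd; split=> // t.
  have [t1 [th [t0 [-> et1 eth et0]]]] := peirce_decomp charF jordanA ee t.
  rewrite 2!jmulDr [z ** t1](jmulC jordanA z t1) (peirce10_mul charF jordanA ee et1 ez).
  have -> : z ** t0 = 0 by rewrite (jmulC jordanA) zS //; exact/mem0.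
  rewrite addr0 add0r; apply: (mulr2n_inj charF); rewrite mul0rn mulr2n.
  rewrite -(@peirce_hom _ charF _ _ jordanA e ee 0 z z th) ?zz ?jmul0l ?jmul0r //.
  by right.
have mem1 x : e ** (e ** x) = e ** x -> e ** x = x.
  move=> eex; apply/eqP; rewrite -subr_eq0; apply/eqP; apply: peirce0_eq0.
  by rewrite jmulBr eex subrr.
have decomp x : exists x1 xh, [/\ x = x1 + xh, e ** x1 = x1 & (e ** xh) *+ 2 = xh].
  have [x1 [xh [x0 [-> ex1 exh /peirce0_eq0 ->]]]] := peirce_decomp charF jordanA ee x.
  by exists x1, xh; rewrite addr0.
(* [U_x] maps the 1-space into the 0-space, now zero. So [x^4 = U_x (x^2) = 0] and
   [U_(x^2) = U_x U_x] kills the 1-space, while [peirce_hom] settles the half space: [x ** x] is an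
   absolute zero divisor. *)
have sqr_h x : (e ** x) *+ 2 = x -> x ** x = 0.
  move=> ex; have exx := mem1 _ (peirceh_mul charF jordanA ee ex ex).
  have Ux1 z : e ** z = z -> jU mul x z = 0.
    move=> ez; apply: peirce0_eq0; have := mul_jU charF jordanA e x z; rewrite ez.
    have -> : jUU mul (e ** x) x z = jU mul x z.
      apply: (mulr2n_inj charF).
      have -> : jUU mul (e ** x) x z *+ 2 = jUU mul ((e ** x) *+ 2) x z by jring.
      by rewrite ex; jring.
    by move/eqP; rewrite -subr_eq0 addrK => /eqP.
  have b2 : (x ** x) ** (x ** x) = 0.
    rewrite -[RHS](Ux1 _ exx); have /= p := jpow_mul charF jordanA x 1 1.
    by rewrite /jU p mulr2n addrK.
  apply: no_azd; split=> // t; have [t1 [th [-> et1 eth]]] := decomp t.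
  rewrite 2!jmulDr; apply: (mulr2n_inj charF); rewrite mul0rn mulrnDl.
  have -> : ((x ** x) ** ((x ** x) ** t1)) *+ 2 = 0.
    by have := jU_sqr charF jordanA x t1; rewrite (Ux1 _ et1) (jU0r jordanA) /jU b2 jmul0l subr0.
  rewrite add0r mulr2n -(@peirce_hom _ charF _ _ jordanA e ee 1 _ _ th exx exx) //;
    rewrite ?b2 ?jmul0l ?jmul0r //.
  by left.
have mul_h x y : (e ** x) *+ 2 = x -> (e ** y) *+ 2 = y -> x ** y = 0.
  move=> ex ey; apply: (mulr2n_inj charF); rewrite mul0rn.
  have exy : (e ** (x + y)) *+ 2 = x + y by rewrite jmulDr mulrnDl ex ey.
  have := sqr_h _ exy; rewrite jmulDl !jmulDr (sqr_h x ex) (sqr_h y ey) add0r addr0.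
  by rewrite (jmulC jordanA y).
move=> x; have [x1 [xh [-> ex1 exh]]] := decomp x; rewrite jmulDr ex1; congr (_ + _).
suff -> : xh = 0 by rewrite jmul0r.
(* The half space has zero products with itself, so it is an ideal; it does not contain [e]. *)
have [|||||//|all_h] := @ideal_cases (fun y => (e ** y) *+ 2 = y) xh.
- by rewrite jmul0r mul0rn.
- by move=> u v eu ev; rewrite jmulDr mulrnDl eu ev.
- by move=> c u eu; rewrite jmulZr scalerMnr eu.
- move=> u v ev; have [u1 [uh [-> eu1 euh]]] := decomp u.
  by rewrite jmulDl (mul_h uh) // addr0 (peirce1h_mul charF jordanA ee eu1 ev).
- exact: exh.
have := all_h e; rewrite ee mulr2n => /(canRL (addrK _)); rewrite subrr => e0'.
by rewrite e0' eqxx in e0.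
Qed.

(** Multiplication by [a] is a 1/2-derivation, denominator cleared. *)
Definition half_multiplier a := forall x y, (a ** (x ** y)) *+ 2 = (a ** x) ** y + x ** (a ** y).

Section HalfMultiplier.

Variables (e a : A).
Hypotheses (e0 : e != 0) (e1 : forall x, e ** x = x) (aP : half_multiplier a).

(* [D x] is the commutator of the multiplications by [a] and [x]; on a half
   multiplier it is a biderivation, alternating in [x] and its argument. *)
Let D x y := a ** (x ** y) - x ** (a ** y).

Let D_anti x y : D x y = - D y x.
Proof. by apply: (lincomb1 (aP x y)); rewrite /D; jring. Qed.

Let D_der x z w : D x (z ** w) = D x z ** w + z ** D x w.
Proof. exact: mul_comm_deriv. Qed.

Let DDl x y z : D (x + y) z = D x z + D y z.
Proof. rewrite /D; jring. Qed.

Let DDr x y z : D z (x + y) = D z x + D z y.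
Proof. rewrite /D; jring. Qed.

(** The identity at [f, f] splits [a] into [f ** a] in the 1-space and [a - f ** a] in the 0-space
    of [f]; multiplications by both commute with that by [f]. *)
Let a_comm f t : f ** f = f -> a ** (f ** t) = f ** (a ** t).
Proof.
move=> ff.
have ffa : f ** (f ** a) = f ** a.
  by have := aP f f; rewrite ff => H; apply: (mulr2n_inj charF); apply: (lincomb1 (esym H)); jring.
have ff0 : f ** (a - f ** a) = 0 by rewrite jmulBr ffa subrr.
have H1 := peirce1_comm charF jordanA ff t ffa; have H0 := peirce0_comm charF jordanA ff t ff0.
by apply: (lincomb2 (esym H1) (esym H0)); jring.
Qed.

Let D_idem f x y : f ** f = f -> f ** D x y = D x (f ** y) /\ f ** D x y = D (f ** x) y.
Proof.
move=> ff.
have Df z : D z f = 0 by rewrite D_anti /D a_comm // subrr oppr0.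
have H u v : f ** D u v = D u (f ** v) by rewrite D_der Df jmul0l add0r.
by split; rewrite ?H // -H D_anti [D (_ ** _) _]D_anti -H -[LHS]/(mul f _) -linearN.
Qed.

(** [K], the part of the 1-space annihilating the half space, is an ideal containing [D x y]; it
    omits [e] because [f != e]. *)
Let D_peirce1 f x y : f ** f = f -> f != e -> f ** x = x -> f ** y = y -> D x y = 0.
Proof.
move=> ff fe fx fy; pose K z := f ** z = z /\ forall w, (f ** w) *+ 2 = w -> z ** w = 0.
have Dh w : (f ** w) *+ 2 = w -> D x w = 0.
  move=> fw; have [H1 H2] := D_idem x w ff; rewrite fx in H2.
  have : D x w *+ 2 = D x ((f ** w) *+ 2) by rewrite -H2 H1 /D; jring.
  by rewrite fw => /eqP; rewrite mulr2n -subr_eq0 addrK => /eqP.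
have KD : K (D x y).
  split=> [|w fw]; first by have [_ ->] := D_idem x y ff; rewrite fx.
  have := D_der x y w; rewrite (Dh w fw) jmul0r addr0 => <-.
  by apply: Dh; exact: peirce1h_mul.
have [|||||//|all_K] := @ideal_cases K (D x y).
- by split=> [|w _]; rewrite ?jmul0r ?jmul0l.
- move=> u v [fu Ku] [fv Kv]; split=> [|w fw]; first by rewrite jmulDr fu fv.
  by rewrite jmulDl Ku ?Kv ?addr0.
- move=> c u [fu Ku]; split=> [|w fw]; first by rewrite jmulZr fu.
  by rewrite jmulZl Ku ?scaler0.
- move=> u v [fv Kv]; have [u1 [uh [u0 [-> fu1 fuh fu0]]]] := peirce_decomp charF jordanA ff u.
  rewrite 2!jmulDl ![_ ** v](jmulC jordanA) (Kv _ fuh).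
  rewrite (peirce10_mul charF jordanA ff fv fu0) !addr0.
  split=> [|w fw]; first exact: peirce1_mul.
  have fvu := peirce1_mul charF jordanA ff fv fu1.
  have -> : (v ** u1) ** w = v ** (u1 ** w) + u1 ** (v ** w).
    by apply: (@peirce_hom _ charF _ _ jordanA f ff 1) => //; left.
  rewrite (Kv w fw) jmul0r addr0; apply: Kv; exact: peirce1h_mul.
- exact: KD.
have [fe1 _] := all_K e; case/eqP: fe.
by rewrite -fe1 (jmulC jordanA) e1.
Qed.

(** By [D_idem], components with distinct eigenvalues give 0; the 1-space and 0-space fall under
    [D_peirce1] for [f] and [e - f]; on the half space, [D x y] lies both in it and in the sum of
    the others. *)
Let D_zero f : f ** f = f -> f != 0 -> f != e -> forall x y, D x y = 0.
Proof.
move=> ff f0 fe.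
have gg : (e - f) ** (e - f) = e - f.
  by rewrite jmulBl !jmulBr !e1 ff (jmulC jordanA f) e1 subrr subr0.
have ge : e - f != e by rewrite -subr_eq0 addrAC subrr add0r oppr_eq0.
have g0 x : f ** x = 0 -> (e - f) ** x = x by move=> fx; rewrite jmulBl e1 fx subr0.
have same c d x y : f ** x = c *: x -> f ** y = d *: y -> c != d -> D x y = 0.
  move=> fx fy cd; have [] := D_idem x y ff; rewrite fx fy => -> /eqP.
  have DZl k u v : D (k *: u) v = k *: D u v by rewrite /D !jmulZl !jmulZr scalerBr.
  have DZr k u v : D u (k *: v) = k *: D u v by rewrite /D !jmulZr scalerBr.
  rewrite DZl DZr -subr_eq0 -scalerBl scaler_eq0 subr_eq0 eq_sym (negPf cd).
  by move/eqP.
have half_eq x : (f ** x) *+ 2 = x -> f ** x = 2^-1 *: x.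
  by move=> fx; rewrite -[in RHS]fx -scaler_nat scalerA (mulVf (two_neq0 charF)) scale1r.
have Dhh x y : (f ** x) *+ 2 = x -> (f ** y) *+ 2 = y -> D x y = 0.
  move=> fx fy; have [H _] := D_idem x y ff.
  have H2 : (f ** D x y) *+ 2 = D x y by rewrite H -[in RHS]fy /D; jring.
  have fay : (f ** (a ** y)) *+ 2 = a ** y by rewrite -(a_comm _ ff) -linearMn /= fy.
  have ffD : f ** (f ** D x y) = f ** D x y.
    rewrite /D !jmulBr (peirceh_mul charF jordanA ff fx fay); congr (_ - _).
    by rewrite -!(a_comm _ ff) (peirceh_mul charF jordanA ff fx fy).
  have fD0 : f ** D x y = 0.
    have := congr1 (mul f) H2; rewrite linearMn /= ffD => /eqP.
    by rewrite mulr2n -subr_eq0 addrK => /eqP.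
  by rewrite -H2 fD0 mul0rn.
have h0 : 2^-1 != 0 :> F by rewrite invr_eq0 two_neq0.
have h1 : 2^-1 != 1 :> F.
  rewrite invr_eq1 -subr_eq0; have -> : 2 - 1 = 1 :> F by ring.
  exact: oner_neq0.
move=> x y; have [x1 [xh [x0 [-> fx1 fxh fx0]]]] := peirce_decomp charF jordanA ff x.
have [y1 [yh [y0 [-> fy1 fyh fy0]]]] := peirce_decomp charF jordanA ff y.
have E1 u : f ** u = u -> f ** u = 1 *: u by rewrite scale1r.
have E0 u : f ** u = 0 -> f ** u = 0 *: u by rewrite scale0r.
have n10 := oner_neq0 F.
rewrite !(DDl, DDr) (D_peirce1 ff fe fx1 fy1) (Dhh _ _ fxh fyh).
rewrite (D_peirce1 gg ge (g0 _ fx0) (g0 _ fy0)).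
have h1' : 1 != 2^-1 :> F by rewrite eq_sym.
have h0' : 0 != 2^-1 :> F by rewrite eq_sym.
have n01 : 0 != 1 :> F by rewrite eq_sym.
rewrite (same _ _ _ _ (E1 _ fx1) (half_eq _ fyh) h1') (same _ _ _ _ (E1 _ fx1) (E0 _ fy0) n10).
rewrite (same _ _ _ _ (half_eq _ fxh) (E1 _ fy1) h1) (same _ _ _ _ (half_eq _ fxh) (E0 _ fy0) h0).
rewrite (same _ _ _ _ (E0 _ fx0) (half_eq _ fyh) h0') (same _ _ _ _ (E0 _ fx0) (E1 _ fy1) n01).
by rewrite !addr0.
Qed.

Lemma half_multiplier_scalar : exists c, forall x, a ** x = c *: x.
Proof.
case: (classic (exists f, [/\ f ** f = f, f != 0 & f != e])) => [[f [ff f0 fe]]|none].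
  have D0 := D_zero ff f0 fe.
  have [c [s [s0 sE]]] : exists c s, s != 0 /\ a ** s = c *: s.
    have [->|[c [q [q0 qE]]]] := jev_eigenvector mul closedF a.
      by exists 0, e; rewrite jmul0l scale0r.
    by exists c, (jev mul a q).
  (* With [D = 0], [a ** (u ** v) = u ** (a ** v)], so the eigenspace is an ideal. *)
  exists c; have [|||||/eqP|//] := @ideal_cases (fun x => a ** x = c *: x) s.
  - by rewrite jmul0r scaler0.
  - by move=> u v au av; rewrite jmulDr au av scalerDr.
  - by move=> k u au; rewrite jmulZr au !scalerA mulrC.
  - move=> u v av; apply/eqP; rewrite -jmulZr -av -subr_eq0; apply/eqP; exact: D0.
  - exact: sE.
  - by rewrite (negPf s0).
have Se x : x \in fullv := memvf x.
have algA : is_subalgebra mul fullv by move=> ? ? _ _; exact: memvf.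
have idemA f : f \in fullv -> f ** f = f -> f = 0 \/ f = e.
  move=> _ ff; have [->|f0] := eqVneq f 0; [by left | right].
  by apply/eqP/negPn/negP => fe; apply: none; exists f.
have nilD x y := @local_nil_add _ charF _ _ jordanA closedF _ e algA (Se e) e0
  (fun x _ => e1 x) idemA x y (Se x) (Se y).
have eig x := @local_eigenvalue _ charF _ _ jordanA closedF _ e algA (Se e)
  (fun x _ => e1 x) idemA x (Se x).
have nil_sqr x : jnil mul x -> jnil mul (x ** x).
  move=> nx; have -> : x ** x = jev mul x 'X by rewrite -(expr1 'X) jev_Xn.
  exact: jnil_jev.
case: (@simpleA (jnil mul)).
- by exists 0.
- by move=> x y nx ny; exact: nilD.
- exact: jnilZ.
- move=> x y ny; have [c nm] := eig x; set m := x - _ in nm.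
  (* Here [x = c e + m] with [m] nil, and [m ** y] is polarized from squares of nilpotents. *)
  have -> : x ** y = c *: y + 2^-1 *: ((m + y) ** (m + y) + (-1) *: (m ** m) + (-1) *: (y ** y)).
    have -> : (m + y) ** (m + y) + (-1) *: (m ** m) + (-1) *: (y ** y) = 2%:R *: (m ** y).
      by rewrite !scaleN1r scaler_nat; jring.
    rewrite scalerA (mulVf (two_neq0 charF)) scale1r.
    by rewrite jmulBl jmulZl e1 addrC subrK.
  have n1 := nil_sqr _ (nilD _ _ nm ny); have n2 := jnilZ (-1) (nil_sqr _ nm).
  have n3 := jnilZ (-1) (nil_sqr _ ny).
  exact: nilD (jnilZ _ ny) (jnilZ _ (nilD _ _ (nilD _ _ n1 n2) n3)).
(* With no nonzero nilpotent, [eig] makes [a] a multiple of [e]. *)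
- by move=> nil0; have [c /nil0/eqP] := eig a; rewrite subr_eq0 => /eqP ->; exists c => x;
    rewrite jmulZl e1.
move=> /(_ e)[n]; have -> : jpow mul e n = e by elim: n => //= n ->.
by move/eqP; rewrite (negPf e0).
Qed.

End HalfMultiplier.

End Simple.

(** * Semisimple algebras *)

Section Transfer.

Variables (F : fieldType) (charF : 2%N \notin [pchar F]).
Variables (A : vectType F) (mul : {bilinear A -> A -> A}).
Hypothesis jordanA : is_jordan mul.

Local Notation "x ** y" := (mul x y) (at level 40, left associativity).
Implicit Types (x y z w t u v : A).
Local Ltac jring := rewrite /jUU /jU /jV; nring mul (jmulC jordanA).

Variable S : {vspace A}.

Definition sub_mul (u v : subvs_of S) : subvs_of S := vsproj S (vsval u ** vsval v).

Lemma sub_mul_bilinear : bilinear_for *:%R *:%R sub_mul.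
Proof.
have vE c (u v : subvs_of S) : vsval (c *: u + v) = c *: vsval u + vsval v by exact: linearP.
split=> [w c u v|w c u v]; rewrite /= /sub_mul vE.
  by rewrite jmulDl jmulZl linearP.
by rewrite jmulDr jmulZr linearP.
Qed.

HB.instance Definition _ := bilinear_isBilinear.Build F (subvs_of S) (subvs_of S)
  (subvs_of S) *:%R *:%R sub_mul sub_mul_bilinear.

Hypothesis simpleS : is_simple_algebra mul S.

Lemma vsval_sub_mul (u v : subvs_of S) : vsval (sub_mul u v) = vsval u ** vsval v.
Proof. by rewrite vsprojK //; case: simpleS => algS _ _; apply: algS; exact: subvsP. Qed.

Lemma sub_jordan : is_jordan sub_mul.
Proof.
split=> [u v|u v]; apply: val_inj; rewrite /= !vsval_sub_mul.
  exact: (jmulC jordanA).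
exact: jordanA.2.
Qed.

(** Simplicity concerns subspaces; [vspace_of_closed] turns [P] into one, whose image in [A] is an
    ideal of [S]. *)
Lemma sub_simple (P : subvs_of S -> Prop) : P 0 -> (forall p q, P p -> P q -> P (p + q)) ->
  (forall c p, P p -> P (c *: p)) -> (forall p q, P q -> P (sub_mul p q)) ->
  (forall p, P p -> p = 0) \/ (forall p, P p).
Proof.
move=> P0 PD PZ PM; have [I IP] := vspace_of_closed P0 PD PZ.
pose J := (linfun vsval @: I)%VS.
have memJ (u : subvs_of S) : vsval u \in J <-> P u.
  rewrite -IP; split=> [/memv_imgP[v Iv]|Iu]; first by rewrite lfunE /= => /val_inj ->.
  by have := memv_img (linfun vsval) Iu; rewrite lfunE.
have sJS : (J <= S)%VS.
  by apply/subvP => _ /memv_imgP[v _ ->]; rewrite lfunE /=; exact: subvsP.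
case: simpleS => algS _ /(_ J)[|J0|JS].
- split=> // x y Sx /memv_imgP[v Iv ->]; rewrite lfunE /=.
  have H : x ** vsval v \in J.
    have -> : x ** vsval v = vsval (sub_mul (vsproj S x) v) by rewrite vsval_sub_mul vsprojK.
    by apply/memJ; apply: PM; apply/IP.
  by split=> //; rewrite (jmulC jordanA).
- left=> u /memJ; rewrite J0 memv0 => /eqP u0; by apply: val_inj; rewrite [LHS]u0 [RHS]linear0.
- by right=> u; apply/memJ; rewrite JS; exact: subvsP.
Qed.

Hypothesis closedF : forall p : {poly F}, size p != 1 -> exists a, root p a.

Lemma simple_unit_scalar : exists e, [/\ e \in S, forall x, x \in S -> e ** x = x &
  forall a, a \in S ->
    (forall x y, x \in S -> y \in S -> (a ** (x ** y)) *+ 2 = (a ** x) ** y + x ** (a ** y)) ->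
  exists c, forall x, x \in S -> a ** x = c *: x].
Proof.
have nontriv : exists p q, sub_mul p q != 0.
  case: simpleS => _ [x [y [Sx Sy xy]]] _; exists (vsproj S x), (vsproj S y).
  by apply: contraNneq xy => /(congr1 vsval); rewrite vsval_sub_mul !vsprojK // linear0 => ->.
have [e [e0 e1]] := exists_unit charF sub_jordan closedF nontriv sub_simple.
exists (vsval e); split=> [|x Sx|a Sa aP]; first exact: subvsP.
  by rewrite -{2}(vsprojK Sx) -(e1 (vsproj S x)) vsval_sub_mul vsprojK.
have [|c cP] := half_multiplier_scalar charF sub_jordan closedF sub_simple e0 e1 (a := vsproj S a).
  move=> x y; apply: val_inj; rewrite mulr2n [LHS]linearD [RHS]linearD /= !vsval_sub_mul.
  by rewrite vsprojK // -mulr2n; apply: aP; exact: subvsP.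
exists c => x Sx; have := congr1 vsval (cP (vsproj S x)).
by rewrite linearZ /= vsval_sub_mul !vsprojK.
Qed.

End Transfer.

(** * Delta-derivations of a semisimple algebra *)

Theorem theorem2p6 (F : closedFieldType) (charF : 2%N \notin [pchar F])
    (A : vectType F) (mul : {bilinear A -> A -> A}) (jordanA : is_jordan mul)
    (n : nat) (A_ : 'I_n -> {vspace A})
    (sumA : is_algebra_direct_sum mul A_)
    (simpleA : forall i : 'I_n, is_simple_algebra mul (A_ i))
    (delta : F) (phi : {linear A -> A})
    (phiP : is_nontrivial_delta_derivation mul delta phi) :
  delta = 2%:R^-1 /\
  exists alpha : 'I_n -> F,
    forall x : 'I_n -> A, (forall i : 'I_n, x i \in A_ i) ->
      phi (\sum_(i < n) x i) = \sum_(i < n) alpha i *: x i.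
Proof.
have closedF (p : {poly F}) : size p != 1 -> exists a, root p a by move/closed_rootP.
have [directA sumAT _ cross] := sumA; have [phi_delta phi_n1 _] := phiP.
have mulC := jmulC jordanA.
have decomp x : exists2 x_ : 'I_n -> A, (forall i, x_ i \in A_ i) & x = \sum_(i < n) x_ i.
  have : x \in (\sum_(i < n) A_ i)%VS by rewrite sumAT memvf.
  by move/memv_sumP => [x_ xA ->]; exists x_ => // i; exact: xA.
have mul_sum (x y : 'I_n -> A) j : (forall i, x i \in A_ i) -> y j \in A_ j ->
    mul (\sum_(i < n) x i) (y j) = mul (x j) (y j).
  move=> xA yA; rewrite mul_suml (bigD1 j) //= big1 ?addr0 // => i ij.
  exact: (cross i j).
have [u uP] := fin_all_exists (fun i => simple_unit_scalar charF jordanA (simpleA i) closedF).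
pose one := \sum_(i < n) u i.
have one_mul x : mul one x = x.
  have [x_ xA ->] := decomp x; rewrite linear_sum; apply: eq_bigr => j _ /=.
  rewrite mul_sum //; last by move=> i; case: (uP i).
  by case: (uP j) => _ ->.
pose a := phi one.
have phiE x : phi x = delta *: (phi x + mul a x).
  by rewrite -{1}(one_mul x) phi_delta one_mul.
(* If [phi one = 0], then [phi = delta phi], so [delta = 1] or [phi = 0], and [phi] would be an
   ordinary derivation. *)
have a0 : a != 0.
  apply/eqP => a0; case: (eqVneq delta 1) => [d1|d1]; first by apply: phi_n1; rewrite -d1.
  apply: phi_n1 => x y; have phi0 z : phi z = 0.
    have := phiE z; rewrite a0 linear0l addr0 -{1}[phi z]scale1r => /eqP.
    rewrite -subr_eq0 -scalerBl scaler_eq0 subr_eq0 eq_sym (negPf d1) /= => /eqP //.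
  by rewrite !phi0 linear0l linear0r addr0 scaler0.
have d2 : delta * 2 = 1.
  have := phiE one; rewrite [mul a one]mulC one_mul -/a -mulr2n -scaler_nat scalerA => /eqP.
  rewrite -{1}[a]scale1r -subr_eq0 -scalerBl scaler_eq0 (negPf a0) orbF subr_eq0.
  by move/eqP => <-.
have n2 := two_neq0 charF.
have dE : delta = 2^-1 by apply: (mulIf n2); rewrite d2 mulVf.
split=> //.
have phi_a x : phi x = mul a x.
  apply/(mulr2n_inj charF); have := congr1 (fun v => 2 *: v) (phiE x).
  rewrite scalerA mulrC d2 scale1r scaler_nat [in LHS]mulr2n mulr2n => /addrI ->.
  by [].
have [a_ aA aE] := decomp a.
have aiE i x : x \in A_ i -> mul a x = mul (a_ i) x.
  by move=> Ax; rewrite aE (@mul_sum a_ (fun _ => x) i).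
(* On [A_ i] the component [a_ i] multiplies like [a], that is like [phi], so it is a half
   multiplier there. *)
have scal i : exists c, forall x, x \in A_ i -> mul (a_ i) x = c *: x.
  have [_ _] := uP i; apply; first exact: aA.
  move=> x y Ax Ay; have [algi _ _] := simpleA i.
  rewrite -(aiE i _ (algi _ _ Ax Ay)) -(aiE i _ Ax) -(aiE i _ Ay) -!phi_a phi_delta.
  by rewrite -scaler_nat scalerA [2 * _]mulrC d2 scale1r addrC.
have [alpha alphaP] := fin_all_exists scal.
exists alpha => x xA; rewrite linear_sum; apply: eq_bigr => i _ /=.
by rewrite phi_a (aiE i _ (xA i)) alphaP.
Qed.
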